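(* Let $p\ge 2$, let $X\subset\mathbb{R}^{p-1}$ be compact and equal to the closure of its interior, let $Y\subset\mathbb{R}$ be compact, and let $f:X\to Y$ be measurable. Let $\mu$, $\mu_0$, $m$, $m_0$, $\delta_0$, and $f_{\beta,d}$ be as in the context, and for $d\in\mathbb{N}$, $d\geq 1$, put $\beta_d:=2^{3-\sqrt d}$. Then: (i) If the set $S\subset X$ of continuity points of $f$ is such that $X\setminus S$ has Lebesgue measure zero, then $f_{\beta_d,d}(\mathbf{x})\to f(\mathbf{x})$ as $d\to\infty$ for almost all $\mathbf{x}\in X$, and $\|f-f_{\beta_d,d}\|_{L^1(X)}\to 0$ as $d\to\infty$. (ii) If $f$ is $L$-Lipschitz on $X$ for some $L>0$, then for any integer $d>1$ and any real $r>p$, $$\|f-f_{\beta_d,d}\|_{L^1(X)}\le \mathrm{vol}(X)\,\frac{\delta_0}{\sqrt d-1}(1+L)+\mathrm{diam}(Y)\,\frac{8(m+m_0)(3r)^{2r}e^{p^2/d}}{p^p\,e^{2r-p}\,d^{\,r-p}}.$$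
   Context: $\mu$ is the Borel measure on $\mathbb{R}^p$ supported on the graph of $f$, $d\mu(\mathbf{x},y)=\mathbb{I}_X(\mathbf{x})\,d\mathbf{x}\,\delta_{f(\mathbf{x})}(dy)$, i.e. $\mu(A)=\mathrm{vol}(\{\mathbf{x}\in X:(\mathbf{x},f(\mathbf{x}))\in A\})$. Write $\mathbf{z}=(\mathbf{x},y)\in\mathbb{R}^p$ and $n_d=\binom{p+d}{d}$. The reference measure $\mu_0$ is a positive Borel measure on $\mathbb{R}^p$, absolutely continuous with respect to Lebesgue measure, with compact support. For each $d$, $\mathbf{b}=(b_1,\dots,b_{n_d})^\top$ is a vector of polynomials in $\mathbf{z}$ of total degree at most $d$ that is orthonormal for $\mu_0$: $\int b_ib_j\,d\mu_0=1$ if $i=j$ and $0$ otherwise. The moment matrix is $\mathbf{M}_{\mu,d}=\int \mathbf{b}(\mathbf{z})\mathbf{b}(\mathbf{z})^\top d\mu(\mathbf{z})$. For $\beta>0$ the regularized Christoffel-Darboux polynomial is $$q_{\mu+\beta\mu_0,d}(\mathbf{z})=\mathbf{b}(\mathbf{z})^\top(\mathbf{M}_{\mu,d}+\beta \mathbf{I}_{n_d})^{-1}\mathbf{b}(\mathbf{z}).$$ The semi-algebraic approximant is $f_{\beta,d}(\mathbf{x}):=\min\{\mathrm{argmin}_{y\in Y}\,q_{\mu+\beta\mu_0,d}(\mathbf{x},y)\}$ for $\mathbf{x}\in X$ (the smallest minimizer). Constants: $\delta_0:=\mathrm{diam}(\mathrm{supp}(\mu+\mu_0))$, $m:=\mu(\mathbb{R}^p)$,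 $m_0:=\mu_0(\mathbb{R}^p)$. The support of a positive Borel measure is the smallest closed set whose complement has measure zero; $\mathrm{vol}$ is Lebesgue measure; $\mathrm{diam}$ is Euclidean diameter. *)

(* Defs.v *)
From HB Require Import structures.
From mathcomp Require Import all_boot all_order all_algebra.
From mathcomp Require Import -(notations) mpoly.
From mathcomp Require Import all_classical all_reals all_analysis.
From mathcomp Require Import measurable_realfun.

Set Implicit Arguments.
Unset Strict Implicit.
Unset Printing Implicit Defensive.
Import Order.TTheory GRing.Theory Num.Theory.
Import numFieldNormedType.Exports.

Local Open Scope classical_set_scope.
Local Open Scope ring_scope.

(* The sup-norm topology of 'rV[R]_n is the Euclidean one, so this is the
   usual Borel sigma-algebra of R^n. *)
HB.instance Definition _ (R : realType) (n : nat) :=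
  Measurable.copy 'rV[R]_n (g_sigma_algebraType (@open 'rV[R]_n)).

Section euclidean_space.
Variable R : realType.

Definition snoc n (x : 'rV[R]_n) (y : R) : 'rV[R]_n.+1 :=
  \row_i oapp (x 0) y (unlift ord_max i).

Definition euclid_dist n (x y : 'rV[R]_n) : R :=
  Num.sqrt (\sum_i (x 0 i - y 0 i) ^+ 2).

(* Meaningful for bounded sets; the diameter of the empty set is 0. *)
Definition diam (T : Type) (dist : T -> T -> R) (A : set T) : R :=
  sup [set dist x y | x in A & y in A].

Lemma borel_open n (U : set 'rV[R]_n) : open U -> measurable U.
Proof. exact: sub_sigma_algebra. Qed.

Let rat_ball n (q : 'rV[rat]_n * nat) : set 'rV[R]_n :=
  @ball R 'rV[R]_n (map_mx ratr q.1) q.2.+1%:R^-1.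

Lemma rV_open_bigcup n (U : set 'rV[R]_n) : open U ->
  U = \bigcup_(q : 'rV[rat]_n * nat)
        [set x | rat_ball q x /\ rat_ball q `<=` U].
Proof.
move=> oU; apply/seteqP; split => [x Ux|x [q _ [qx]]]; last exact.
have /nbhs_ballP[e /= e0 xeU] : nbhs x U by exact: open_nbhs_nbhs.
have e20 : 0 < e / 2 by rewrite divr_gt0.
pose k := Num.trunc ((e / 2)^-1).
have ke : k.+1%:R^-1 <= e / 2 :> R.
  by rewrite invf_ple ?posrE//; apply/ltW/truncnS_gt.
have k0 : 0 < k.+1%:R^-1 :> R by rewrite invr_gt0.
have xk i : x 0 i - k.+1%:R^-1 < x 0 i + k.+1%:R^-1.
  by rewrite ltrD2l (lt_trans _ k0)// oppr_lt0.
pose qf i := projT1 (cid (rat_in_itvoo (xk i))).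
have qfP i : ratr (qf i) \in `]x 0 i - k.+1%:R^-1, x 0 i + k.+1%:R^-1[.
  by rewrite /qf; case: cid.
have qx : rat_ball (\row_i qf i, k) x.
  split=> // i j; rewrite !mxE ord1; have := qfP j.
  by rewrite /ball/= in_itv/= -ltr_distlC distrC.
exists (\row_i qf i, k) => //; split => //= y qy; apply: xeU.
have := ball_triangle (ball_sym qx) qy.
by apply: le_ball; rewrite [leRHS](splitr e) lerD.
Qed.

Lemma measurable_snoc n :
  measurable_fun [set: 'rV[R]_n * R] (fun z => snoc z.1 z.2).
Proof.
apply: (measurability (@open 'rV[R]_n.+1)) => // _ [U oU <-].
rewrite setTI (rV_open_bigcup oU) preimage_bigcup.
apply: countable_bigcupT_measurable; first exact: countableP.
move=> [q k] /=; set r : R := k.+1%:R^-1.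
have [qU|qU] := pselect (rat_ball (q, k) `<=` U); last first.
  by rewrite [X in measurable X](_ : _ = set0)// -subset0 => z [_ /qU].
rewrite [X in measurable X](_ : _ =
    ball (\row_i ratr (q 0 (lift ord_max i)) : 'rV[R]_n) r `*`
    ball (ratr (q 0 ord_max) : R) r).
  apply: measurableX; last by apply: open_measurable; exact: ball_open.
  by have := borel_open (@ball_open R 'rV[R]_n _ _); exact.
apply/seteqP; split => [[x y] /= [[r0 qz] _]|[x y] /= [[r0 qx] qy]].
- split; last by have := qz 0 ord_max; rewrite !mxE unlift_none.
  by split=> // i j; have := qz 0 (lift ord_max j); rewrite !mxE liftK ord1.
- split=> //; split=> // i j; rewrite !mxE ord1; case: unliftP => [j' ->|->//].
  by have := qx 0 j'; rewrite !mxE.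
Qed.

(* R^(n+1) = R^n x R. *)
Fixpoint lebesgue n : set 'rV[R]_n -> \bar R :=
  match n with
  | 0 => \d_(0 : 'rV[R]_0)
  | n'.+1 => pushforward (@lebesgue n' \x lebesgue_measure)%E
               (fun z : 'rV[R]_n' * R => snoc z.1 z.2)
  end.

Lemma lebesgue_measureP n :
  exists mu : {measure set 'rV[R]_n -> \bar R}, @lebesgue n = mu.
Proof.
elim: n => [|n [mu muE]]; first by exists \d_(0 : 'rV[R]_0).
exists (measure_function_pushforward__canonical__measure_function_Measure
  (mu \x lebesgue_measure)%E (@measurable_snoc n)).
by rewrite /= muE.
Qed.

Let lebesgue0 n : @lebesgue n set0 = 0%E.
Proof. by have [mu ->] := lebesgue_measureP n. Qed.

Let lebesgue_ge0 n A : (0 <= @lebesgue n A)%E.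
Proof. by have [mu ->] := lebesgue_measureP n. Qed.

Let lebesgue_sigma_additive n : semi_sigma_additive (@lebesgue n).
Proof.
by have [mu ->] := lebesgue_measureP n; exact: measure_semi_sigma_additive.
Qed.

HB.instance Definition _ n := isMeasure.Build _ _ _ (@lebesgue n)
  (@lebesgue0 n) (@lebesgue_ge0 n) (@lebesgue_sigma_additive n).

End euclidean_space.

Section christoffel_darboux.
Variable R : realType.

(* The pushforward of Lebesgue measure on X by x |-> (x, f x). It is kept as a
   bare set function: it is a measure on Borel sets only under the hypotheses
   that X is Borel and f is measurable on X. *)
Definition graph_measure n (X : set 'rV[R]_n) (f : 'rV[R]_n -> R) :
    set 'rV[R]_n.+1 -> \bar R :=
  fun A => lebesgue [set x | X x /\ A (snoc x (f x))].

Definition measure_support n (nu : set 'rV[R]_n -> \bar R) : set 'rV[R]_n :=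
  \bigcap_(F in [set F | closed F /\ nu (~` F) = 0%E]) F.

Definition peval n (P : mpoly.mpoly n R) (z : 'rV[R]_n) : R :=
  mpoly.meval (z 0) P.

(* mpoly.msize is the total degree plus one, and 0 for the zero polynomial. *)
Definition orthonormal_polys n N (nu : set 'rV[R]_n -> \bar R) (d : nat)
    (b : 'I_N -> mpoly.mpoly n R) : Prop :=
  (forall i, (mpoly.msize (b i) <= d.+1)%N) /\
  (forall i j,
    (\int[nu]_z (peval (b i) z * peval (b j) z)%:E = (i == j)%:R%:E)%E).

Definition moment_matrix n N (nu : set 'rV[R]_n -> \bar R)
    (b : 'I_N -> mpoly.mpoly n R) : 'M[R]_N :=
  \matrix_(i, j) fine (\int[nu]_z (peval (b i) z * peval (b j) z)%:E)%E.

Definition cd_poly n N (nu : set 'rV[R]_n -> \bar R) (beta : R)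
    (b : 'I_N -> mpoly.mpoly n R) (z : 'rV[R]_n) : R :=
  let bz : 'cV[R]_N := \col_i peval (b i) z in
  (bz^T *m invmx (moment_matrix nu b + beta%:M) *m bz) 0 0.

Definition argmin (T : Type) (Y : set T) (g : T -> R) : set T :=
  [set y | Y y /\ forall y', Y y' -> g y <= g y'].

(* The least element of A (0 if there is none). *)
Definition set_min (A : set R) : R := xget 0 (A `&` lbound A).

Definition cd_approx n N (nu : set 'rV[R]_n.+1 -> \bar R) (beta : R)
    (b : 'I_N -> mpoly.mpoly n.+1 R) (Y : set R) (x : 'rV[R]_n) : R :=
  set_min (argmin Y (fun y => cd_poly nu beta b (snoc x y))).

(* Continuity for the topology induced on X, as for a function X -> R. *)
Definition continuity_points n (X : set 'rV[R]_n) (f : 'rV[R]_n -> R) :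
    set 'rV[R]_n :=
  [set x | X x /\ f @ within X (nbhs x) --> f x].

Definition L1norm n (X : set 'rV[R]_n) (g : 'rV[R]_n -> R) : \bar R :=
  (\int[@lebesgue R n]_(x in X) `|g x|%:E)%E.

End christoffel_darboux.

(* Main.v *)
Require Import Defs.
From HB Require Import structures.
From mathcomp Require Import all_boot all_order all_algebra.
From mathcomp Require Import -(notations) mpoly.
From mathcomp Require Import all_classical all_reals all_analysis.
From mathcomp Require Import measurable_realfun ring lra.

Set Implicit Arguments.
Unset Strict Implicit.
Unset Printing Implicit Defensive.
Import Order.TTheory GRing.Theory Num.Theory.
Import numFieldNormedType.Exports.
Local Open Scope classical_set_scope.
Local Open Scope ring_scope.

(** Write [q d] for the polynomial [cd_poly] of degree parameter [d], and
    [supp] for the support of a measure. Two facts about [q d] are played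
    against each other.

    On the graph of [f] it is rarely large. Its integral against [mu] is the
    trace of [(M + beta I)^-1 M], at most the dimension ['C(p + d, d)]
    ([pint_cd_poly_le]), so Markov's inequality bounds the measure of the set
    of [x] such that [q d] exceeds a threshold at [(x, f x)]
    ([cd_poly_markov], [bad_set]).

    Away from the graph it is large. The value of [q d] at [z] is at least the
    inverse of the integral of [P ^ 2] against [mu + beta mu0], for every
    polynomial [P] of degree at most [d] with [P z = 1] ([cd_poly_ge]). When
    [z] is at distance more than [delta0 / (sqrt d - 1)] from [supp mu], a
    Chebyshev polynomial in the squared distance to [z] ([needle_mpoly]) is at
    most 1 on [supp mu0] and has its square at most [beta] on [supp mu], so that
    [q d z >= 1 / ((m + m0) beta)] ([cd_poly_away]). This number is the threshold.

    The approximant [fd d x] minimizes [q d] over the fiber of [x], so it does not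
    exceed the threshold as soon as [f x] does not. Off the bad set,
    [(x, fd d x)] is thus within nearly [delta0 / (sqrt d - 1)] of some
    [(x', f x')] ([cd_approx_close]). For a Lipschitz [f] this bounds the
    error at [x], and the bad set contributes at most its measure times the
    diameter of [Y]; [bin_tail_le] puts this measure into closed form. For an
    [f] that is continuous almost everywhere, the measures of the bad sets are
    summable, which gives almost everywhere convergence by Borel-Cantelli; for
    convergence in L1, the set of [x] near which [f] oscillates by more than
    a given amount at scale [1 / (k + 1)] has measure tending to 0
    ([oscillation_set_cvg0]). *)

(** * Positive definite matrices *)

Section positive_definite.
Variables (R : realFieldType) (n : nat).

Definition quad (N : 'M[R]_n) (u v : 'cV[R]_n) : R := (u^T *m N *m v) 0 0.

Definition pos_def (N : 'M[R]_n) : Prop :=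
  N^T = N /\ forall v, v != 0 -> 0 < quad N v v.

Lemma quadC (N : 'M[R]_n) u v : N^T = N -> quad N u v = quad N v u.
Proof.
move=> sN; have -> : quad N u v = (u^T *m N *m v)^T 0 0 by rewrite mxE.
by rewrite !trmx_mul trmxK sN mulmxA.
Qed.

Lemma pos_def_unitmx N : pos_def N -> N \in unitmx.
Proof.
move=> [sN pN]; rewrite -unitmx_tr -row_free_unit; apply: inj_row_free => v vN.
apply/eqP; apply/negPn/negP => v0.
have : 0 < quad N v^T v^T by apply: pN; rewrite trmx_eq0.
by rewrite /quad trmxK -sN vN mul0mx mxE ltxx.
Qed.

Lemma quad_invmx N (b : 'cV[R]_n) : pos_def N ->
  quad (invmx N) b b = quad N (invmx N *m b) (invmx N *m b).
Proof.
move=> pN; have uN := pos_def_unitmx pN; case: pN => sN _.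
by rewrite /quad -[in RHS]mulmxA mulKVmx// trmx_mul trmx_inv sN.
Qed.

Lemma quad_invmx_ge0 N (b : 'cV[R]_n) : pos_def N -> 0 <= quad (invmx N) b b.
Proof.
move=> pN; rewrite quad_invmx//; case: pN => _ pN.
by have [->|/pN/ltW//] := eqVneq (invmx N *m b) 0; rewrite /quad mulmx0 mxE.
Qed.

(** The minimum of [quad N a a] over the vectors with [a^T b = 1] is the inverse
    of [quad (invmx N) b b]; applied to coefficient vectors of polynomials, this
    is the extremal characterization of the Christoffel function. *)
Lemma pos_def_invmx_ge N (a b : 'cV[R]_n) s : pos_def N ->
  (a^T *m b) 0 0 = 1 -> quad N a a <= s -> s^-1 <= quad (invmx N) b b.
Proof.
move=> pN; have uN := pos_def_unitmx pN; have vv := quad_invmx b pN.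
case: pN => sN pN ab1 aas.
have a0 : a != 0.
  by apply: contra_eq_neq ab1 => ->; rewrite trmx0 mul0mx mxE eq_sym oner_neq0.
have s0 : 0 < s by exact: lt_le_trans (pN _ a0) aas.
set v := invmx N *m b in vv.
have av : quad N a v = 1 by rewrite /quad -mulmxA mulKVmx.
have : 0 <= quad N (a - s *: v) (a - s *: v).
  by case: (eqVneq (a - s *: v) 0) => [->|/pN/ltW//]; rewrite /quad mulmx0 mxE.
have -> : quad N (a - s *: v) (a - s *: v) =
    quad N a a - s * quad N a v - s * quad N v a + s ^+ 2 * quad N v v.
  have -> w w' : quad N (w - w') (w - w') =
      quad N w w - quad N w w' - quad N w' w + quad N w' w'.
    rewrite /quad [(w - w')^T]linearB/= mulmxBl mulmxBl mulmxBr mulmxBr.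
    by rewrite !(mxE, summxE); ring.
  have Zr w : quad N w (s *: v) = s * quad N w v.
    by rewrite /quad -scalemxAr mxE.
  rewrite (quadC (s *: v) a sN) !Zr (quadC (s *: v) v sN) Zr (quadC v a sN).
  by ring.
rewrite (quadC v a sN) av -vv => h.
rewrite -[s^-1]mul1r ler_pdivrMr//; set q := quad _ b b in h *.
rewrite -(ler_pM2l s0); nra.
Qed.

(** In [N = M + beta%:M], the trace of [invmx N *m M] is that of
    [1 - beta *: invmx N]. *)
Lemma mxtrace_invmx_mul_le M (beta : R) : 0 <= beta -> pos_def (M + beta%:M) ->
  \tr (invmx (M + beta%:M) *m M) <= n%:R.
Proof.
move=> b0 pN; have uN := pos_def_unitmx pN.
set N := M + beta%:M in uN pN *.
have -> : invmx N *m M = 1%:M - beta *: invmx N.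
  rewrite -(mulVmx uN) -[M](addrK beta%:M) -/N mulmxBr.
  by rewrite mul_mx_scalar.
rewrite linearB/= linearZ/= mxtrace1 gerBl mulr_ge0//.
apply: sumr_ge0 => i _.
have -> : invmx N i i = quad (invmx N) (delta_mx i 0) (delta_mx i 0).
  by rewrite /quad -mulmxA -colE trmx_delta -rowE !mxE.
exact: quad_invmx_ge0.
Qed.

Lemma pos_def1 : pos_def 1%:M.
Proof.
split=> [|v v0]; first exact: trmx1.
rewrite /quad mulmx1 mxE (eq_bigr (fun i => v i 0 ^+ 2)); last first.
  by move=> i _; rewrite mxE expr2.
rewrite lt_neqAle sumr_ge0 ?andbT//; last by move=> i _; exact: sqr_ge0.
apply: contraNneq v0 => /esym/eqP; rewrite psumr_eq0; last first.
  by move=> i _; exact: sqr_ge0.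
move=> /allP v0; apply/eqP/matrixP => i j; rewrite ord1 mxE.
by have := v0 i; rewrite mem_index_enum sqrf_eq0 => /(_ isT)/eqP.
Qed.

End positive_definite.

(** * Polynomials of bounded degree *)

Section polynomials_of_bounded_degree.
Variables (R : realFieldType) (p d : nat).

(** A monomial is the tuple of its exponents. *)
Lemma card_bmultinom : (#|{: bmultinom p d.+1}| <= 'C(p + d, d))%N.
Proof.
rewrite -bin_sub ?leq_addl// addnK -card_partial_ord_partitions.
pose h (m : bmultinom p d.+1) : p.-tuple 'I_d.+1 := [tuple inord (m i) | i < p].
have mle (m : bmultinom p d.+1) i : (m i < d.+1)%N.
  by have := bmdeg m; apply: leq_ltn_trans; rewrite mdegE (bigD1 i)//= leq_addr.
have hE m i : tnth (h m) i = m i :> nat by rewrite tnth_mktuple inordK.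
have hi : injective h.
  move=> m m' mm'; apply/val_inj/mnmP => i; rewrite -[LHS]hE -[RHS]hE.
  by rewrite mm'.
rewrite -(card_codom hi); apply: subset_leq_card.
apply/fintype.subsetP => _ /codomP[m ->].
rewrite inE big_tuple; under eq_bigr do rewrite hE.
by rewrite -mdegE -ltnS bmdeg.
Qed.

(** There are at most ['C(p + d, d)] monomials of degree at most [d], so as many
    independent polynomials span: their coefficient matrix, with as many rows
    and at most as many columns, is square and invertible. *)
Lemma mpoly_basis (b : 'I_('C(p + d, d)) -> mpoly.mpoly p R)
    (P : mpoly.mpoly p R) :
  (forall i, (mpoly.msize (b i) <= d.+1)%N) ->
  (forall a : 'I_('C(p + d, d)) -> R, \sum_i a i *: b i = 0 ->
    forall i, a i = 0) ->
  (mpoly.msize P <= d.+1)%N ->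
  exists a : 'I_('C(p + d, d)) -> R, P = \sum_i a i *: b i.
Proof.
move=> bd bfree Pd.
pose mon j : multinom p := @enum_val (bmultinom p d.+1) predT j.
pose C := \matrix_(i < 'C(p + d, d), j < #|{: bmultinom p d.+1}|)
  mpoly.mcoeff (mon j) (b i).
have eqP' (Q Q' : mpoly.mpoly p R) : (mpoly.msize Q <= d.+1)%N ->
    (mpoly.msize Q' <= d.+1)%N ->
    (forall j, mpoly.mcoeff (mon j) Q = mpoly.mcoeff (mon j) Q') -> Q = Q'.
  move=> Qd Q'd QQ'; apply/mpolyP => m; have [md|dm] := ltnP (mdeg m) d.+1.
    have := QQ' (enum_rank (BMultinom md)).
    by rewrite /mon enum_rankK.
  rewrite !memN_msupp_eq0//; apply: msize_mdeg_ge; [exact: leq_trans dm|].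
  exact: leq_trans dm.
have sumd (a : 'I_('C(p + d, d)) -> R) :
    (mpoly.msize (\sum_i a i *: b i) <= d.+1)%N.
  rewrite (leq_trans (msize_sum _ _ _))//; apply/bigmax_leqP => i _.
  exact: leq_trans (msizeZ_le _ _) (bd i).
have coefE (a : 'I_('C(p + d, d)) -> R) j :
    mpoly.mcoeff (mon j) (\sum_i a i *: b i) = ((\row_i a i) *m C) 0 j.
  by rewrite raddf_sum/= mxE; apply: eq_bigr => i _; rewrite !mxE -mcoeffZ.
have freeC : row_free C.
  apply: inj_row_free => v vC; apply/rowP => i; rewrite mxE.
  have vE : v = \row_i v 0 i by apply/rowP => k; rewrite mxE.
  apply: (bfree (v 0)); apply: eqP' => //; first by rewrite msize0.
  by move=> j; rewrite coefE -vE vC mcoeff0 mxE.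
have fullC : row_full C.
  rewrite /row_full eqn_leq rank_leq_col/= (eqP freeC).
  exact: card_bmultinom.
have /submxP[u uE] : (\row_j mpoly.mcoeff (mon j) P <= C)%MS.
  exact: submx_full.
exists (u 0); apply: eqP' => // j; rewrite coefE.
have -> : \row_i u 0 i = u by apply/rowP => k; rewrite mxE.
by rewrite -uE mxE.
Qed.

End polynomials_of_bounded_degree.

(** * Chebyshev polynomials *)

(** Stated over any commutative ring, so as to speak of the Chebyshev polynomial
    evaluated at a multivariate polynomial as well as at a real number. *)
Fixpoint cheb (A : comNzRingType) (k : nat) (x : A) : A :=
  match k with
  | 0 => 1
  | k'.+1 => match k' with
             | 0 => x
             | k''.+1 => 2%:R * x * cheb k' x - cheb k'' x
             end
  end.

Lemma chebSS (A : comNzRingType) k (x : A) :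
  cheb k.+2 x = 2%:R * x * cheb k.+1 x - cheb k x.
Proof. by []. Qed.

(** The three-term recurrence calls for the hypothesis at two consecutive indices. *)
Lemma nat_ind2 (P : nat -> Prop) :
  P 0%N -> P 1%N -> (forall k, P k -> P k.+1 -> P k.+2) -> forall k, P k.
Proof.
move=> P0 P1 PSS k; suff : P k /\ P k.+1 by case.
by elim: k => // k [Pk Pk1]; split => //; exact: PSS.
Qed.

Lemma meval_cheb (R : comNzRingType) n (v : 'I_n -> R) k (Q : mpoly.mpoly n R) :
  mpoly.meval v (cheb k Q) = cheb k (mpoly.meval v Q).
Proof.
elim/nat_ind2: k => [|//|k IHk IHk1]; first exact: meval1.
by rewrite !chebSS mevalB !mevalM IHk IHk1 rmorph_nat.
Qed.

Lemma msize_mul_le (R : idomainType) n k l (P Q : mpoly.mpoly n R) :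
  (mpoly.msize P <= k.+1)%N -> (mpoly.msize Q <= l.+1)%N ->
  (mpoly.msize (P * Q) <= (k + l).+1)%N.
Proof.
move=> Pk Ql; have [->|P0] := eqVneq P 0; first by rewrite mul0r msize0.
have [->|Q0] := eqVneq Q 0; first by rewrite mulr0 msize0.
by rewrite msizeM// -subn1 leq_subLR add1n -addSn -addnS leq_add.
Qed.

Lemma msize_cheb (R : idomainType) n e k (Q : mpoly.mpoly n R) :
  (mpoly.msize Q <= e.+1)%N -> (mpoly.msize (cheb k Q) <= (k * e).+1)%N.
Proof.
move=> Qe; elim/nat_ind2: k => [|//|k IHk IHk1].
- by rewrite msize1.
- by rewrite mul1n.
rewrite chebSS (leq_trans (msizeD_le _ _))// msizeN geq_max; apply/andP; split.
  rewrite mulSn msize_mul_le// mulr_natl mulr2n (leq_trans (msizeD_le _ _))//.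
  by rewrite maxnn.
by rewrite (leq_trans IHk)// ltnS leq_mul2r (leq_trans (leqnSn k))// orbT.
Qed.

Section chebyshev_growth.
Variable R : realType.
Implicit Types (x y u : R).

Lemma cheb_cos k x : cheb k (cos x) = cos (k%:R * x).
Proof.
elim/nat_ind2: k => [||k IHk IHk1]; rewrite ?mul0r ?cos0 ?mul1r//.
have -> : k.+2%:R * x = k.+1%:R * x + x by rewrite -addn1 natrD; ring.
rewrite chebSS IHk IHk1.
have -> : k%:R * x = k.+1%:R * x - x by rewrite -[k.+1]addn1 natrD; ring.
by rewrite cosB cosD; ring.
Qed.

Lemma cheb_norm_le1 k x : -1 <= x <= 1 -> `|cheb k x| <= 1.
Proof.
move=> x1; rewrite -(@acosK _ x) ?in_itv//= cheb_cos ler_norml.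
by rewrite cos_geN1 cos_le1.
Qed.

(** The hyperbolic counterpart of [cheb_cos], which describes [cheb] outside
    [-1; 1]. *)
Lemma cheb_joukowski k u : u != 0 ->
  cheb k ((u + u^-1) / 2) = (u ^+ k + (u ^+ k)^-1) / 2.
Proof.
move=> u0; elim/nat_ind2: k => [||k IHk IHk1].
- by rewrite /= expr0 invr1; field.
- by rewrite expr1.
have := expf_neq0 k u0; rewrite chebSS IHk IHk1 !exprS; set a := u ^+ k => a0.
by field; rewrite a0.
Qed.

Lemma joukowski_surj x : 1 <= x -> exists2 u, 1 <= u & x = (u + u^-1) / 2.
Proof.
move=> x1; have x21 : 0 <= x ^+ 2 - 1 by rewrite subr_ge0 exprn_ege1.
have s0 := sqrtr_ge0 (x ^+ 2 - 1); have s2 := sqr_sqrtr x21.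
set s := Num.sqrt _ in s0 s2.
exists (x + s); first by rewrite (le_trans x1)// lerDl.
have -> : (x + s)^-1 = x - s.
  have xs0 : x + s != 0 by rewrite gt_eqF// ltr_wpDr// (lt_le_trans _ x1).
  apply: (mulfI xs0); rewrite divff//.
  by transitivity (x ^+ 2 - s ^+ 2); [rewrite s2|]; ring.
by field.
Qed.

Lemma addV_le u v : 1 <= u -> u <= v -> u + u^-1 <= v + v^-1.
Proof.
move=> u1 uv; have u0 : 0 < u by exact: lt_le_trans u1.
have v0 : 0 < v by exact: lt_le_trans uv.
have uv1 : 1 <= u * v by rewrite mulr_ege1// (le_trans u1).
rewrite -subr_ge0.
have -> : v + v^-1 - (u + u^-1) = (v - u) * (u * v - 1) / (u * v).
  by field; rewrite !gt_eqF.
by rewrite divr_ge0 ?mulr_ge0 ?subr_ge0// ltW.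
Qed.

Lemma addV_le_inv u v : 1 <= u -> 1 <= v -> u + u^-1 <= v + v^-1 -> u <= v.
Proof.
move=> u1 v1 uv; rewrite leNgt; apply/negP => vu.
have u0 : 0 < u by exact: lt_le_trans u1.
have v0 : 0 < v by exact: lt_le_trans v1.
have uv1 : 1 < u * v by rewrite (lt_le_trans (le_lt_trans v1 vu))// ler_peMr// ltW.
move: uv; rewrite leNgt -subr_gt0.
have -> : u + u^-1 - (v + v^-1) = (u - v) * (u * v - 1) / (u * v).
  by field; rewrite !gt_eqF.
by rewrite divr_gt0 ?mulr_gt0 ?subr_gt0.
Qed.

Lemma cheb_le k x y : 1 <= x -> x <= y -> cheb k x <= cheb k y.
Proof.
move=> x1 xy.
have [u u1 xE] := joukowski_surj x1.
have [v v1 yE] := joukowski_surj (le_trans x1 xy).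
have uv : u <= v.
  by apply: addV_le_inv => //; move: xy; rewrite xE yE ler_pM2r// invr_gt0.
rewrite xE yE !cheb_joukowski ?gt_eqF ?(lt_le_trans ltr01)//.
rewrite ler_pM2r ?invr_gt0// addV_le ?exprn_ege1//.
by rewrite lerXn2r ?nnegrE ?(le_trans ler01).
Qed.

(** Up to 1, Chebyshev polynomials are bounded by 1 in absolute value; beyond 1,
    they increase. *)
Lemma cheb_norm_le k x y : -1 <= x <= y -> 1 <= y -> `|cheb k x| <= cheb k y.
Proof.
move=> /andP[x1 xy] y1; have T1 : cheb k (1 : R) = 1.
  by have := cheb_cos k 0; rewrite mulr0 cos0.
have [x_le1|/ltW x_ge1] := leP x 1.
  by rewrite (le_trans (@cheb_norm_le1 k x _)) ?x1// -{1}T1 cheb_le.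
by rewrite ger0_norm ?cheb_le// (le_trans ler01)// -T1 cheb_le.
Qed.

Lemma cheb_ge k u x : 1 <= u -> (u + u^-1) / 2 <= x -> u ^+ k / 2 <= cheb k x.
Proof.
move=> u1 ux; have u0 : 0 < u by exact: lt_le_trans u1.
rewrite (le_trans _ (cheb_le k _ ux))//.
  rewrite cheb_joukowski ?gt_eqF// ler_pM2r ?invr_gt0//.
  by rewrite lerDl invr_ge0 exprn_ge0// ltW.
by have := addV_le (lexx 1) u1; rewrite invr1; lra.
Qed.

End chebyshev_growth.

(** * Numerical estimates *)

Section estimates.
Variable R : realType.

Lemma ln2_ge : 2 / 3 <= ln 2 :> R.
Proof.
(* [expR 14^-1 <= 14 / 13] bounds [expR 2] by [(14 / 13) ^+ 28], which is below
   8 *)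
have e14 : expR (14^-1) <= 14 / 13 :> R.
  have := expR_ge1Dx (- 14^-1 : R); rewrite expRN => h.
  rewrite -[leLHS]invrK -[leRHS]invrK lef_pV2 ?posrE ?invr_gt0 ?expR_gt0//.
  by rewrite (le_trans _ h)//; lra.
have e2 : expR 2 <= 8 :> R.
  have -> : 2 = 28%:R * 14^-1 :> R by field.
  rewrite expRM_natl (@le_trans _ _ ((14 / 13) ^+ 28))//.
    by rewrite lerXn2r ?nnegrE ?expR_ge0//; lra.
  by rewrite expr_div_n ler_pdivrMr; lra.
have : ln (expR 2) <= ln (8 : R) by rewrite ler_ln ?posrE ?expR_gt0.
rewrite expRK (_ : 8 = 2 ^+ 3); last by ring.
by rewrite lnXn//; lra.
Qed.

Lemma natr_sqrt_gt1 d : (1 < d)%N -> 1 < Num.sqrt d%:R :> R.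
Proof.
by move=> d1; rewrite -[ltLHS]sqrtr1 ltr_sqrt ?ltr0n ?ltr1n// (ltn_trans _ d1).
Qed.

(** With [u := (sqrt d + 1) / (sqrt d - 1)], the mean of [u] and [u^-1] is
    [(d + 1) / (d - 1)], and [u >= expR (2 / (sqrt d + 1))], so that
    [u ^+ (d - 1) >= expR (2 * (sqrt d - 1))]. *)
Lemma cheb_needle_ge d (x : R) : (1 < d)%N -> (d%:R + 1) / (d%:R - 1) <= x ->
  2 `^ (Num.sqrt d%:R - 3) <= cheb d./2 x ^+ 2.
Proof.
move=> d1 dx; have s1 := natr_sqrt_gt1 d1.
have sd : Num.sqrt d%:R ^+ 2 = d%:R :> R by rewrite sqr_sqrtr.
set s := Num.sqrt _ in s1 sd *.
pose u := (s + 1) / (s - 1).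
have s10 : 0 < s - 1 by rewrite subr_gt0.
have s11 : 0 < s + 1 by lra.
have u1 : 1 <= u by rewrite ler_pdivlMr//; lra.
have u0 : 0 < u by exact: lt_le_trans u1.
have uE : (u + u^-1) / 2 = (d%:R + 1) / (d%:R - 1).
  rewrite -sd /u; field; rewrite (gt_eqF s10) (gt_eqF s11)/= andbT.
  by rewrite gt_eqF// subr_gt0 expr_gt1// ltW// (lt_trans _ s1).
have Tu : u ^+ d./2 / 2 <= cheb d./2 x by rewrite cheb_ge// uE.
have ue : expR (2 / (s + 1)) <= u.
  have -> : u = (1 - 2 / (s + 1))^-1 by rewrite /u; field; rewrite !gt_eqF//; lra.
  rewrite -[leLHS]invrK lef_pV2 ?posrE ?invr_gt0 ?expR_gt0//; last first.
    by rewrite subr_gt0 ltr_pdivrMr//; lra.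
  by rewrite -expRN expR_ge1Dx.
have ud : expR (2 * (s - 1)) <= u ^+ d./2.*2.
  rewrite (@le_trans _ _ (u ^+ d.-1))//; last first.
    rewrite ler_weXn2l// -ltnS prednK ?(ltn_trans _ d1)//.
    by rewrite -[in leqLHS](odd_double_half d) -addn1 addnC leq_add2l leq_b1.
  rewrite (_ : 2 * (s - 1) = d.-1%:R * (2 / (s + 1))); last first.
    rewrite -subn1 natrB ?(ltnW d1)// -sd; field.
    by rewrite gt_eqF.
  by rewrite expRM_natl lerXn2r ?nnegrE ?expR_ge0// ltW.
have -> : 2 `^ (s - 3) = 2 `^ (s - 1) / 2 ^+ 2 :> R.
  rewrite (_ : s - 3 = s - 1 - 2%:R); last by ring.
  by rewrite powRB ?pnatr_eq0 ?implybT// powR_mulrn.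
rewrite (@le_trans _ _ ((u ^+ d./2 / 2) ^+ 2))//; last first.
  by rewrite lerXn2r ?nnegrE ?divr_ge0 ?exprn_ge0 ?(ltW u0)//
    (le_trans _ Tu)// divr_ge0 ?exprn_ge0 ?(ltW u0).
rewrite expr_div_n -exprM muln2 ler_pM2r ?invr_gt0 ?exprn_gt0//.
rewrite (le_trans _ ud)// /powR gt_eqF// ler_expR mulrC ler_pM2r//.
exact/ltW/ln_sublinear.
Qed.

(** One term of the exponential series. *)
Lemma exprn_le_fact_expR p : p%:R ^+ p <= p`!%:R * expR p%:R :> R.
Proof.
case: p => [|p]; first by rewrite expr0 fact0 expR0 mulr1.
have := @expR_ge1Dxn R p.+1%:R p (ler0n _ _); set f := _`!%:R => h.
have f0 : 0 < f by rewrite /f ltr0n fact_gt0.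
by rewrite mulrC -ler_pdivrMr// (le_trans _ h)// lerDr.
Qed.

Lemma bin_fact_le p d : ('C(p + d, d) * p`! <= (p + d) ^ p)%N.
Proof.
rewrite -bin_sub ?leq_addl// addnK bin_ffact ffact_prod.
rewrite -[p in (_ ^ p)%N]card_ord -prod_nat_const leq_prod// => i _.
exact: leq_subr.
Qed.

(** Taking logarithms, with [x := s / (3 * r)], this is [1 + ln x <= x], since
    [3 / 2 * ln 2 >= 1]. *)
Lemma powR2N_le (s r : R) : 0 < s -> 0 < r ->
  2 `^ (- s) * expR (2 * r) * s `^ (2 * r) <= (3 * r) `^ (2 * r).
Proof.
move=> s0 r0; have r30 : 0 < 3 * r by rewrite mulr_gt0.
rewrite /powR !gt_eqF// -!expRD ler_expR.
have l2 := ln2_ge; pose x := s / (3 * r).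
have x0 : 0 < x by rewrite divr_gt0.
have lx : ln x <= x - 1.
  by have := @le_ln1Dx R (x - 1); rewrite subrKC; apply; rewrite ltrBrDr addNr.
have -> : ln s = ln x + ln (3 * r).
  by rewrite -lnM ?posrE// /x divfK// gt_eqF.
have sE : s = x * (3 * r) by rewrite /x divfK// gt_eqF.
rewrite sE.
have h1 : x * r * 2 <= x * (3 * r) * ln 2.
  have -> : x * (3 * r) * ln 2 = x * r * (3 * ln 2) by ring.
  by rewrite ler_wpM2l ?(mulr_ge0 (ltW x0) (ltW r0))//; lra.
have h2 : 2 * r * ln x <= 2 * r * (x - 1) by rewrite ler_wpM2l// mulr_ge0// ltW.
by nra.
Qed.

(** Bounds [p`!] below by [(p / e) ^ p], [1 + p / d] above by [expR (p / d)], and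
    [2 `^ (- sqrt d)] by a power of [d]. *)
Lemma bin_tail_le p d (r : R) : (1 < d)%N -> p%:R < r ->
  'C(p + d, d)%:R * 2 `^ (- Num.sqrt d%:R) <=
  (3 * r) `^ (2 * r) * expR (p%:R ^+ 2 / d%:R) /
    (p%:R ^+ p * expR (2 * r - p%:R) * d%:R `^ (r - p%:R)).
Proof.
move=> d1 pr; have s1 : 1 < Num.sqrt d%:R := natr_sqrt_gt1 d1.
have sd : Num.sqrt d%:R ^+ 2 = d%:R :> R by rewrite sqr_sqrtr.
set s := Num.sqrt _ in s1 sd *.
have s0 : 0 < s by rewrite (lt_trans _ s1).
have d0 : 0 < d%:R :> R by rewrite ltr0n (ltn_trans _ d1).
have r0 : 0 < r by rewrite (le_lt_trans _ pr).
have sr : s `^ (2 * r) = d%:R `^ r by rewrite powRrM powR_mulrn ?ltW// sd.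
have := powR2N_le s0 r0; rewrite sr => tail.
have pp : 0 < p%:R ^+ p :> R by case: (p) => [|q]; rewrite ?expr0 ?exprn_gt0.
rewrite ler_pdivlMr ?mulr_gt0 ?expR_gt0 ?powR_gt0//.
rewrite expRB powRB ?(gt_eqF d0) ?implybT// powR_mulrn ?ler0n//.
have binE : 'C(p + d, d)%:R * p%:R ^+ p <=
    d%:R ^+ p * expR (p%:R ^+ 2 / d%:R) * expR p%:R :> R.
  rewrite (@le_trans _ _ ('C(p + d, d)%:R * (p`!%:R * expR p%:R)))//.
    by rewrite ler_wpM2l// exprn_le_fact_expR.
  rewrite mulrA ler_pM2r ?expR_gt0// (@le_trans _ _ ((p + d)%:R ^+ p))//.
    by rewrite -natrM -natrX ler_nat bin_fact_le.
  rewrite (_ : p%:R ^+ 2 / d%:R = p%:R * (p%:R / d%:R)); last by ring.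
  rewrite expRM_natl -exprMn lerXn2r ?nnegrE ?mulr_ge0 ?expR_ge0//.
  have -> : (p + d)%:R = d%:R * (1 + p%:R / d%:R) :> R.
    by rewrite natrD; field; exact: lt0r_neq0.
  by rewrite ler_wpM2l ?expR_ge1Dx// ltW.
set C := 'C(_, _)%:R in binE *; set E := expR (_ ^+ 2 / _) in binE *.
have ep0 := expR_gt0 (p%:R : R); have dp0 : 0 < d%:R ^+ p :> R by rewrite exprn_gt0.
set ep := expR p%:R in binE ep0 *; set dp := d%:R ^+ p in binE dp0 *.
have -> : C * 2 `^ (- s) * (p%:R ^+ p * (expR (2 * r) / ep) * (d%:R `^ r / dp)) =
    (2 `^ (- s) * expR (2 * r) * d%:R `^ r) * (C * p%:R ^+ p / (ep * dp)).
  by field; rewrite !gt_eqF.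
rewrite ler_pM ?mulr_ge0 ?powR_ge0 ?expR_ge0 ?exprn_ge0 ?invr_ge0 ?mulr_ge0
  ?ler0n ?(ltW ep0) ?(ltW dp0)//.
rewrite ler_pdivrMr ?mulr_gt0// (le_trans binE)// le_eqVlt.
by apply/orP/or_introl/eqP; ring.
Qed.

End estimates.

(** * Euclidean distance and Borel sets *)

Section euclidean_geometry.
Variable R : realType.

Lemma sqr_sum_mul_le (I : finType) (a b : I -> R) :
  (\sum_i a i * b i) ^+ 2 <= (\sum_i a i ^+ 2) * (\sum_i b i ^+ 2).
Proof.
set A := \sum_i a i ^+ 2; set B := \sum_i b i ^+ 2; set C := \sum_i a i * b i.
have h : forall t, 0 <= (Poly [:: A; 2 * C; B]).[t].
  move=> t; rewrite horner_Poly/= mul0r add0r.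
  rewrite (_ : _ + A = \sum_i (a i + t * b i) ^+ 2).
    by apply: sumr_ge0 => i _; exact: sqr_ge0.
  rewrite (eq_bigr (fun i => a i ^+ 2 + (2 * t) * (a i * b i) + t ^+ 2 * b i ^+ 2)).
    by rewrite !big_split/= -!mulr_sumr -/A -/B -/C; ring.
  by move=> i _; ring.
have := @deg_le2_poly_ge0 R (Poly [:: A; 2 * C; B]) (size_Poly _) h.
rewrite !coef_Poly/= => D; lra.
Qed.

Variable n : nat.
Implicit Types x y z : 'rV[R]_n.

Lemma euclid_dist_ge0 x y : 0 <= euclid_dist x y.
Proof. exact: sqrtr_ge0. Qed.

Lemma sqr_euclid_dist x y :
  euclid_dist x y ^+ 2 = \sum_i (x 0 i - y 0 i) ^+ 2.
Proof. by rewrite sqr_sqrtr// sumr_ge0// => i _; exact: sqr_ge0. Qed.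

Lemma euclid_distC x y : euclid_dist x y = euclid_dist y x.
Proof. by congr Num.sqrt; apply: eq_bigr => i _; rewrite -sqrrN opprB. Qed.

Lemma euclid_dist_triangle y x z :
  euclid_dist x z <= euclid_dist x y + euclid_dist y z.
Proof.
rewrite -ler_sqr ?nnegrE ?addr_ge0 ?euclid_dist_ge0// sqrrD !sqr_euclid_dist.
rewrite (eq_bigr (fun i => (x 0 i - y 0 i) ^+ 2 +
    2 * ((x 0 i - y 0 i) * (y 0 i - z 0 i)) + (y 0 i - z 0 i) ^+ 2)); last first.
  by move=> i _; ring.
rewrite !big_split/= -mulr_sumr lerD2r lerD2l mulr_natl lerMn2r/=.
rewrite (le_trans (ler_norm _))// -ler_sqr ?nnegrE ?mulr_ge0 ?euclid_dist_ge0//.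
rewrite real_normK ?num_real// exprMn !sqr_euclid_dist.
exact: sqr_sum_mul_le.
Qed.

Lemma ler_coord_euclid_dist x y i : `|x 0 i - y 0 i| <= euclid_dist x y.
Proof.
rewrite -ler_sqr ?nnegrE ?euclid_dist_ge0// real_normK ?num_real//.
rewrite sqr_euclid_dist (bigD1 i)//= lerDl sumr_ge0// => j _; exact: sqr_ge0.
Qed.

Lemma euclid_dist_le_coord x y B : 0 <= B ->
  (forall i, `|x 0 i - y 0 i| <= B) -> euclid_dist x y <= Num.sqrt n%:R * B.
Proof.
move=> B0 xyB; rewrite -ler_sqr ?nnegrE ?euclid_dist_ge0 ?mulr_ge0//.
rewrite sqr_euclid_dist exprMn sqr_sqrtr// (@le_trans _ _ (\sum_(i < n) B ^+ 2))//.
  by apply: ler_sum => i _; rewrite -real_normK ?num_real// lerXn2r ?nnegrE.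
by rewrite sumr_const card_ord mulr_natl.
Qed.

Lemma euclid_dist_ball x y r : euclid_dist x y < r -> ball x r y.
Proof.
move=> xyr; split=> [|i j].
  by rewrite (le_lt_trans _ xyr)// euclid_dist_ge0.
by rewrite ord1 /ball/= (le_lt_trans (ler_coord_euclid_dist _ _ _)).
Qed.

Lemma continuous_euclid_dist y : continuous (fun x => euclid_dist x y).
Proof.
move=> x; apply: (@continuous_comp _ _ _ _ (@Num.sqrt R)); last first.
  exact: sqrt_continuous.
apply: (@continuous_big R _ +%R 0 xpredT) => [|i _ z]; first exact: add_continuous.
rewrite (_ : (fun z : 'rV_n => _) = (fun z => (z 0 i - y 0 i) * (z 0 i - y 0 i))).
  have c : {for z, continuous (fun z : 'rV[R]_n => z 0 i - y 0 i)}.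
    by apply: continuousB; [exact: coord_continuous|exact: cst_continuous].
  exact: (continuousM c c).
by apply/funext => w; rewrite expr2.
Qed.

End euclidean_geometry.

Section snoc.
Variables (R : realType) (n : nat).
Implicit Types (x : 'rV[R]_n) (y : R).

Lemma snoc_max x y : snoc x y 0 ord_max = y.
Proof. by rewrite mxE unlift_none. Qed.

Lemma snoc_lift x y i : snoc x y 0 (lift ord_max i) = x 0 i.
Proof. by rewrite mxE liftK. Qed.

Lemma ler_euclid_dist_snoc x x' y y' :
  euclid_dist x x' <= euclid_dist (snoc x y) (snoc x' y').
Proof.
rewrite -ler_sqr ?nnegrE ?euclid_dist_ge0// !sqr_euclid_dist big_ord_recr/=.
rewrite ler_wpDr ?sqr_ge0//; apply: ler_sum => i _.
have -> : widen_ord (leqnSn n) i = lift ord_max i.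
  by apply: val_inj; rewrite /= /bump leqNgt ltn_ord.
by rewrite !snoc_lift.
Qed.

Lemma continuous_snoc x : continuous (snoc x).
Proof.
move=> y; apply/cvg_ballP => e e0; near=> z; split=> // i j; rewrite !mxE.
case: unliftP => [k _|_]/=; first exact: ballxx.
by near: z; apply: (@nbhsx_ballx R R y e e0).
Unshelve. all: by end_near. Qed.

End snoc.

Section borel.
Variable R : realType.

Lemma borel_closed n (F : set 'rV[R]_n) : closed F -> measurable F.
Proof. by move=> /closed_openC/borel_open/measurableC; rewrite setCK. Qed.

Lemma continuous_borel_fun n (f : 'rV[R]_n -> R) :
  continuous f -> measurable_fun setT f.
Proof.
move=> /continuousP cf; apply: (measurability _ (RGenOpens.measurableE R)).
move=> _ [_ [a [b ->] <-]]; rewrite setTI; apply: borel_open.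
exact/cf/interval_open.
Qed.

Lemma continuous_peval n (P : mpoly.mpoly n R) : continuous (peval P).
Proof.
have cM (g h : 'rV[R]_n -> R) : continuous g -> continuous h ->
    continuous (fun z => g z * h z).
  by move=> cg ch z; exact: (continuousM (cg z) (ch z)).
rewrite /peval; under eq_fun do rewrite mevalE.
apply: (@continuous_big R _ +%R 0 xpredT) => [|m _]; first exact: add_continuous.
apply: (cM _ _); first by move=> z; exact: cst_continuous.
apply: (@continuous_big R _ *%R 1 xpredT) => [|i _]; first exact: mul_continuous.
elim: (m i) => [|k IHk].
  by under eq_fun do rewrite expr0; move=> z; exact: cst_continuous.
under eq_fun do rewrite exprS.
by apply: (cM _ _) => //; exact: coord_continuous.
Qed.

Lemma measurable_peval n (P : mpoly.mpoly n R) : measurable_fun setT (peval P).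
Proof. by apply: continuous_borel_fun; exact: continuous_peval. Qed.

Definition cube n (B : R) : set 'rV[R]_n := [set x | forall i, `|x 0 i| <= B].

Lemma compact_cube n (A : set 'rV[R]_n) : compact A ->
  exists2 B, 0 <= B & A `<=` cube B.
Proof.
move=> /compact_bounded[M [_ AM]]; exists (`|M| + 1); first by rewrite addr_ge0.
move=> x Ax i; have := AM (`|M| + 1) _ x Ax; rewrite ltr_pwDr ?ler_norm// => /(_ isT).
apply: le_trans; rewrite [leRHS]/Num.norm/= mx_normrE.
by apply/bigmax_geP; right => /=; exists (0, i).
Qed.

Lemma closed_cube n (B : R) : closed (@cube n B).
Proof.
rewrite (_ : cube B = \bigcap_i [set x : 'rV[R]_n | `|x 0 i| <= B]).
  apply: closed_bigI => i _.
  apply: (@closed_comp _ _ (fun x : 'rV[R]_n => `|x 0 i|) [set r | r <= B]).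
    move=> x _; apply: continuous_comp; first exact: coord_continuous.
    exact: norm_continuous.
  exact: closed_le.
by apply/seteqP; split=> [x h i _|x h i]; [exact: h|exact: (h i)].
Qed.

Lemma bounded_closed_cube n (A : set 'rV[R]_n) (B : R) :
  0 <= B -> closed A -> A `<=` cube B -> compact A.
Proof.
move=> B0 cA AB; apply: bounded_closed_compact => //.
exists B; split; first exact: num_real.
move=> M BM x Ax; rewrite /Num.norm/= mx_normrE; apply: bigmax_le => [|[i j] _ /=].
  by rewrite (le_trans B0)// ltW.
by rewrite ord1 (le_trans (AB x Ax j))// ltW.
Qed.

Lemma lebesgue_cube_fin n (B : R) :
  (lebesgue (@cube n B) < +oo)%E.
Proof.
elim: n => [|n IHn] /=; first by rewrite diracE ltry.
rewrite /pushforward [X in (_ \x _)%E X](_ : _ =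
    @cube n B `*` `[- B, B]%classic).
  have [mu muE] := lebesgue_measureP R n; rewrite muE product_measure1E//; last first.
    exact: borel_closed (@closed_cube n B).
  rewrite -muE lte_mul_pinfty// ?measure_ge0//.
    by rewrite ge0_fin_numE// muE.
  have := lebesgue_measure_itv `[- B, B] => /= ->.
  by case: ifP => _; rewrite -?EFinB ltry.
apply/seteqP; split => [[x y]/= xyB|[x y]/= [xB yB] i].
  split=> [i|]; first by have := xyB (lift ord_max i); rewrite snoc_lift.
  by have := xyB ord_max; rewrite snoc_max in_itv/= ler_norml.
case: (unliftP ord_max i) => [j ->|->]; first by rewrite snoc_lift.
by rewrite snoc_max ler_norml; move: yB; rewrite in_itv.
Qed.

Lemma compact_lebesgue_fin n (A : set 'rV[R]_n) : compact A -> (lebesgue A < +oo)%E.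
Proof.
move=> cA; have [B _ AB] := compact_cube cA.
apply: le_lt_trans (lebesgue_cube_fin n B); apply: le_measure => //; rewrite inE.
  exact: borel_closed (compact_closed (@norm_hausdorff _ _) cA).
exact: borel_closed (@closed_cube n B).
Qed.

End borel.

(** * Supports, graph measures and moments *)

Section support.
Variables (R : realType) (n : nat).

Lemma closed_measure_support (nu : set 'rV[R]_n -> \bar R) :
  closed (measure_support nu).
Proof. by apply: closed_bigI => F []. Qed.

Lemma measure_support_sub (nu : set 'rV[R]_n -> \bar R) F :
  closed F -> nu (~` F) = 0%E -> measure_support nu `<=` F.
Proof. by move=> cF nF x; apply. Qed.

(** The complement of the support is covered by the null balls with rational
    center and radius, of which there are countably many. *)
Lemma measure_support_null (nu : {measure set 'rV[R]_n -> \bar R}) :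
  nu (~` measure_support nu) = 0%E.
Proof.
have oS : open (~` measure_support nu).
  by apply: closed_openC; exact: closed_measure_support.
pose B (q : 'rV[rat]_n * nat) : set 'rV[R]_n :=
  @ball R 'rV[R]_n (map_mx ratr q.1) q.2.+1%:R^-1.
have mB q : measurable (B q) by apply: borel_open; exact: ball_open.
pose F k := if unpickle k is Some q then [set x | B q x /\ nu (B q) = 0%E] else set0.
have F0 k : nu.-negligible (F k).
  rewrite /F; case: unpickle => [q|]; last exact: negligible_set0.
  have [q0|q0] := pselect (nu (B q) = 0%E).
    by exists (B q); split => // x [].
  by exists set0; split => // x [].
apply: measure_negligible; first exact: borel_open.
apply: negligibleS (negligible_bigcup F0) => x xS.
have [C [[cC C0] Cx]] : exists C, (closed C /\ nu (~` C) = 0%E) /\ ~ C x.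
  apply/not_existsP => H; apply: xS => C CP; apply: contrapT => Cx.
  exact: (H C (conj CP Cx)).
have oC : open (~` C) by exact: closed_openC.
have : (~` C) x by [].
rewrite (rV_open_bigcup oC) => -[q _ [qx qC]].
exists (pickle q) => //; rewrite /F pickleK; split => //.
apply/eqP; rewrite eq_le measure_ge0 andbT -C0 le_measure ?inE//.
exact: borel_open.
Qed.

End support.

Section graph_measure.
Variables (R : realType) (n : nat) (X : set 'rV[R]_n) (f : 'rV[R]_n -> R).
Hypotheses (mX : measurable X) (mf : measurable_fun X f).

Lemma measurable_graph : measurable_fun setT (fun x => snoc x ((f \_ X) x)).
Proof.
apply: (measurableT_comp (@measurable_snoc R n) (f := fun z => snoc z.1 z.2)
  (g := fun x => (x, (f \_ X) x))).
by apply: measurable_fun_pair => //; exact/(measurable_restrictT _ _).1.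
Qed.

(** The graph map is measurable on [X] only, so [f] is first extended by 0; the
    graph measure is the image of the restriction of Lebesgue measure to [X]. *)
Lemma graph_measureP :
  exists mu : {measure set 'rV[R]_n.+1 -> \bar R}, graph_measure X f = mu.
Proof.
exists (measure_function_pushforward__canonical__measure_function_Measure
  (mrestr (@lebesgue R n) mX) measurable_graph).
apply/funext => A; rewrite /graph_measure /= /pushforward /mrestr.
congr lebesgue; apply/seteqP; split => x /=.
  by move=> [Xx Ax]; split => //; rewrite patchE mem_set.
by move=> [Ax Xx]; split => //; move: Ax; rewrite patchE mem_set.
Qed.

End graph_measure.

Section integrals_of_polynomials.
Variables (R : realType) (n : nat) (nu : {measure set 'rV[R]_n -> \bar R}).

Lemma integrable_peval (S : set 'rV[R]_n) (P : mpoly.mpoly n R) :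
  (nu setT < +oo)%E -> compact S -> nu (~` S) = 0%E ->
  nu.-integrable setT (EFin \o peval P).
Proof.
move=> nuT cS S0; have mS : measurable S.
  exact: borel_closed (compact_closed (@norm_hausdorff _ _) cS).
apply/(negligible_integrable (N := ~` S)) => //; first exact: measurableC.
  by apply: measurableT_comp => //; exact: measurable_peval.
rewrite setTD setCK; apply: measurable_bounded_integrable => //.
- by rewrite (le_lt_trans _ nuT)// le_measure ?inE.
- by apply: measurable_funTS; exact: measurable_peval.
- have : compact (peval P @` S).
    apply: continuous_compact => //; apply: continuous_subspaceT.
    exact: continuous_peval.
  move=> /compact_bounded[M [Mr MP]]; exists M; split => // M' /MP + x Sx.
  by apply; exists x.
Qed.

Hypothesis intP : forall P : mpoly.mpoly n R, nu.-integrable setT (EFin \o peval P).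

Definition pint (P : mpoly.mpoly n R) : R := (\int[nu]_z peval P z)%R.

Lemma pintD P Q : pint (P + Q) = pint P + pint Q.
Proof.
rewrite /pint -RintegralD//; apply: eq_Rintegral => z _.
by rewrite /peval mevalD.
Qed.

Lemma pintZ a P : pint (a *: P) = a * pint P.
Proof.
by rewrite /pint -RintegralZl//; apply: eq_Rintegral => z _; rewrite /peval mevalZ.
Qed.

Lemma pint0 : pint 0 = 0.
Proof. by have := pintZ 0 0; rewrite scale0r mul0r. Qed.

Lemma pint_sum (I : Type) (r : seq I) (F : I -> mpoly.mpoly n R) :
  pint (\sum_(i <- r) F i) = \sum_(i <- r) pint (F i).
Proof. exact: (big_morph pint pintD pint0). Qed.

Lemma pint_sqr_ge0 P : 0 <= pint (P * P).
Proof.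
by apply: Rintegral_ge0 => z _; rewrite /peval mevalM -expr2 sqr_ge0.
Qed.

Lemma pint_sqr_le (S : set 'rV[R]_n) P c : measurable S ->
  (nu setT < +oo)%E -> nu (~` S) = 0%E -> 0 <= c ->
  (forall z, S z -> peval P z ^+ 2 <= c) -> pint (P * P) <= c * fine (nu setT).
Proof.
move=> mS nuT S0 c0 Pc; rewrite /pint /Rintegral.
rewrite (_ : c * _ = fine (\int[nu]_z cst c%:E z)%E); last first.
  by rewrite integral_cst// fineM// ge0_fin_numE.
apply: fine_le.
- exact: (integrable_fin_num measurableT (intP _)).
- by rewrite integral_cst// fin_numM// ge0_fin_numE.
apply: ae_ge0_le_integral => //.
- by move=> z _; rewrite lee_fin /peval mevalM -expr2 sqr_ge0.
- by apply: measurableT_comp => //; exact: measurable_peval.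
exists (~` S); split => //; first exact: measurableC.
move=> z /=; apply: contra_not => Sz _.
by rewrite lee_fin /peval mevalM -expr2 Pc.
Qed.

Lemma moment_matrixE N (b : 'I_N -> mpoly.mpoly n R) i j :
  moment_matrix nu b i j = pint (b i * b j).
Proof.
by rewrite mxE; apply: eq_Rintegral => z _; rewrite /peval mevalM.
Qed.

Lemma moment_matrix_tr N (b : 'I_N -> mpoly.mpoly n R) :
  (moment_matrix nu b)^T = moment_matrix nu b.
Proof. by apply/matrixP => i j; rewrite mxE !moment_matrixE mulrC. Qed.

(** The moment matrix is the Gram matrix of [b], for the scalar product given by
    the integral of the product. *)
Lemma pint_combination_mul N (b : 'I_N -> mpoly.mpoly n R) (u v : 'cV[R]_N) :
  pint ((\sum_i u i 0 *: b i) * (\sum_j v j 0 *: b j)) =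
  quad (moment_matrix nu b) u v.
Proof.
rewrite mulr_sumr pint_sum /quad mxE; apply: eq_bigr => j _.
rewrite mulr_suml pint_sum mxE mulr_suml; apply: eq_bigr => i _.
by rewrite -scalerAl -scalerAr !pintZ moment_matrixE mxE; ring.
Qed.

End integrals_of_polynomials.

(** * The Christoffel function *)

Section christoffel_function.
Variables (R : realType) (p d : nat).
Variables (mu mu0 : {measure set 'rV[R]_p -> \bar R}).
Hypothesis int_mu : forall P : mpoly.mpoly p R, mu.-integrable setT (EFin \o peval P).
Hypothesis int_mu0 : forall P : mpoly.mpoly p R, mu0.-integrable setT (EFin \o peval P).
Variable b : 'I_('C(p + d, d)) -> mpoly.mpoly p R.
Hypothesis b_on : orthonormal_polys mu0 d b.
Variable beta : R.
Hypothesis beta0 : 0 < beta.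

Let N := moment_matrix mu b + beta%:M.

Lemma moment_matrix_orthonormal : moment_matrix mu0 b = 1%:M.
Proof. by apply/matrixP => i j; rewrite !mxE (b_on.2 i j). Qed.

Lemma quad_regularized_moment_matrix (a : 'cV[R]_('C(p + d, d))) :
  let P := \sum_i a i 0 *: b i in
  quad N a a = pint mu (P * P) + beta * pint mu0 (P * P).
Proof.
move=> P; rewrite !pint_combination_mul// moment_matrix_orthonormal.
rewrite /quad mulmxDr mulmxDl mxE; congr (_ + _).
by rewrite mul_mx_scalar mulmx1 -scalemxAl mxE.
Qed.

Lemma pos_def_regularized_moment_matrix : pos_def N.
Proof.
split=> [|v v0].
  by rewrite /N linearD/= moment_matrix_tr tr_scalar_mx.
rewrite quad_regularized_moment_matrix ltr_wpDl ?pint_sqr_ge0// mulr_gt0//.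
rewrite pint_combination_mul// moment_matrix_orthonormal.
exact: (pos_def1 _ _).2.
Qed.

(** The Gram matrix of [b] for [mu0] is the identity, hence definite. *)
Lemma orthonormal_polys_free (a : 'I_('C(p + d, d)) -> R) :
  \sum_i a i *: b i = 0 -> forall i, a i = 0.
Proof.
pose v : 'cV[R]_('C(p + d, d)) := \col_i a i.
rewrite (eq_bigr (fun i => v i 0 *: b i)) => [P0 i|i _]; last by rewrite mxE.
have [v0|/(pos_def1 _ _).2] := eqVneq v 0.
  have -> : a i = v i 0 by rewrite mxE.
  by rewrite v0 mxE.
rewrite -moment_matrix_orthonormal -pint_combination_mul// P0 mul0r.
by rewrite pint0// ltxx.
Qed.

(** Any polynomial normalized at [z] bounds the Christoffel function at [z] from
    above, hence its inverse [cd_poly] from below. *)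
Lemma cd_poly_ge (P : mpoly.mpoly p R) z s : (mpoly.msize P <= d.+1)%N ->
  peval P z = 1 -> pint mu (P * P) + beta * pint mu0 (P * P) <= s ->
  s^-1 <= cd_poly mu beta b z.
Proof.
move=> Pd Pz Ps.
have [a PE] := mpoly_basis b_on.1 orthonormal_polys_free Pd.
pose v : 'cV[R]_('C(p + d, d)) := \col_i a i.
have {}PE : P = \sum_i v i 0 *: b i.
  by rewrite PE; apply: eq_bigr => i _; rewrite mxE.
apply: (pos_def_invmx_ge (a := v) pos_def_regularized_moment_matrix); last first.
  by rewrite quad_regularized_moment_matrix -PE.
rewrite -Pz PE /peval raddf_sum/= mxE; apply: eq_bigr => i _.
by rewrite mevalZ !mxE.
Qed.

Lemma cd_poly_ge0 z : 0 <= cd_poly mu beta b z.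
Proof. exact: quad_invmx_ge0 pos_def_regularized_moment_matrix. Qed.

Definition cd_mpoly : mpoly.mpoly p R :=
  \sum_i \sum_j invmx N i j *: (b i * b j).

Lemma cd_polyE z : cd_poly mu beta b z = peval cd_mpoly z.
Proof.
rewrite /cd_poly /= -mulmxA mxE /peval /cd_mpoly raddf_sum/=.
apply: eq_bigr => i _; rewrite raddf_sum/= !mxE mulr_sumr.
by apply: eq_bigr => j _; rewrite mevalZ mevalM !mxE; ring.
Qed.

Lemma continuous_cd_poly : continuous (cd_poly mu beta b).
Proof.
rewrite (_ : cd_poly _ _ _ = peval cd_mpoly); last exact/funext/cd_polyE.
exact: continuous_peval.
Qed.

(** The integral of [cd_poly] against [mu] is the trace of
    [invmx N *m moment_matrix mu b]. *)
Lemma pint_cd_poly_le : pint mu cd_mpoly <= 'C(p + d, d)%:R.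
Proof.
apply: le_trans (mxtrace_invmx_mul_le (ltW beta0) pos_def_regularized_moment_matrix).
rewrite /cd_mpoly pint_sum// /mxtrace -/N le_eqVlt; apply/orP; left; apply/eqP.
apply: eq_bigr => i _; rewrite pint_sum// mxE; apply: eq_bigr => j _.
by rewrite pintZ// moment_matrixE mulrC [b j * _]mulrC mulrC.
Qed.

Lemma cd_poly_markov t : 0 < t ->
  (mu [set z | (t <= cd_poly mu beta b z)%R] <= ('C(p + d, d)%:R / t)%:E)%E.
Proof.
move=> t0; have mq : measurable_fun setT (EFin \o peval cd_mpoly).
  by apply: measurableT_comp => //; exact: measurable_peval.
have q0 z : 0 <= peval cd_mpoly z by rewrite -cd_polyE cd_poly_ge0.
have := le_integral_comp_abse mu measurableT (f := id)
  (@measurable_id _ _ _) (fun r h => h) (fun x y _ _ h => h) mq t0.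
rewrite setTI (_ : [set _ | _] = [set z | t <= cd_poly mu beta b z]); last first.
  by apply/seteqP; split => z /=; rewrite cd_polyE lee_fin ger0_norm.
under eq_integral do rewrite /= ger0_norm//.
rewrite -[X in (_ <= X)%E](@fineK _); last first.
  exact: (integrable_fin_num measurableT (int_mu _)).
move=> /= h; rewrite -(@lee_pmul2l _ t%:E)// (le_trans h)//.
rewrite -EFinM lee_fin mulrC divfK ?gt_eqF//.
exact: pint_cd_poly_le.
Qed.

End christoffel_function.

(** * Lower bound away from the support *)

Section needle.
Variables (R : realType) (p : nat).
Implicit Types (z w : 'rV[R]_p).

Definition sqr_dist_mpoly z : mpoly.mpoly p R :=
  \sum_i (mpoly.mpolyX R (mnm1 i) - mpoly.mpolyC p (z 0 i)) ^+ 2.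

Lemma peval_sqr_dist_mpoly z w :
  peval (sqr_dist_mpoly z) w = euclid_dist w z ^+ 2.
Proof.
rewrite sqr_euclid_dist /peval raddf_sum/=; apply: eq_bigr => i _.
by rewrite rmorphXn/= mevalB mevalXU mevalC.
Qed.

Lemma msize_sqr_dist_mpoly z : (mpoly.msize (sqr_dist_mpoly z) <= 3)%N.
Proof.
rewrite (leq_trans (msize_sum _ _ _))//; apply/bigmax_leqP => i _.
have h : (mpoly.msize (mpoly.mpolyX R (mnm1 i) - mpoly.mpolyC p (z 0%R i))%R <= 2)%N.
  rewrite (leq_trans (msizeD_le _ _))// msizeN geq_max msizeX mdeg1/=.
  by rewrite msizeC; case: eqP.
by rewrite expr2 (@msize_mul_le _ _ 1 1).
Qed.

(** A Chebyshev polynomial composed with the affine function of the squared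
    distance to [z] that sends [A; B] onto [1; -1]. At [z] its argument lies to
    the right of 1, where Chebyshev polynomials grow fastest. *)
Lemma needle_mpoly d z (A B : R) : (1 < d)%N -> 0 <= A -> A < B ->
  (d%:R + 1) / (d%:R - 1) <= (A + B) / (B - A) ->
  exists P : mpoly.mpoly p R, [/\ (mpoly.msize P <= d.+1)%N, peval P z = 1,
    forall w, A <= euclid_dist w z ^+ 2 <= B ->
      peval P w ^+ 2 <= 2 `^ (3 - Num.sqrt d%:R) &
    forall w, euclid_dist w z ^+ 2 <= B -> peval P w ^+ 2 <= 1].
Proof.
move=> d1 A0 AB dAB; have BA0 : 0 < B - A by rewrite subr_gt0.
set x := (A + B) / (B - A) in dAB.
have x1 : 1 <= x by rewrite ler_pdivlMr//; lra.
have T0 : 0 < cheb d./2 x.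
  rewrite (lt_le_trans ltr01)// -{1}(@normr1 R).
  rewrite (le_trans _ (cheb_norm_le (x := 1) _ _ _))//; last lra.
  by have := cheb_cos d./2 (0 : R); rewrite mulr0 cos0 => ->; rewrite normr1.
pose G := mpoly.mpolyC p x - (2 / (B - A)) *: sqr_dist_mpoly z.
have GE w : peval G w = (A + B - 2 * euclid_dist w z ^+ 2) / (B - A).
  rewrite -peval_sqr_dist_mpoly /peval mevalB mevalC mevalZ /x.
  by field; rewrite gt_eqF.
pose P := (cheb d./2 x)^-1 *: cheb d./2 G.
have PE w : peval P w = cheb d./2 (peval G w) / cheb d./2 x.
  by rewrite /peval mevalZ meval_cheb mulrC.
have Gx w : euclid_dist w z ^+ 2 <= B -> -1 <= peval G w <= x.
  have := sqr_ge0 (euclid_dist w z); rewrite GE; set t := _ ^+ 2 => t0 tB.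
  by rewrite ler_pM2r ?invr_gt0// ler_pdivlMr//; apply/andP; split; lra.
exists P; split.
- rewrite (leq_trans (msizeZ_le _ _))//.
  apply: (@leq_trans (d./2 * 2).+1); last first.
    by rewrite ltnS muln2 -[leqRHS]odd_double_half leq_addl.
  apply: msize_cheb; rewrite (leq_trans (msizeD_le _ _))// msizeN geq_max.
  rewrite msizeC (leq_trans (leq_b1 _))//=.
  by rewrite (leq_trans (msizeZ_le _ _))// msize_sqr_dist_mpoly.
- have z0 : euclid_dist z z ^+ 2 = 0.
    by rewrite sqr_euclid_dist big1// => i _; rewrite subrr expr0n.
  by rewrite PE GE z0 mulr0 subr0 -/x divff// gt_eqF.
- move=> w /andP[Aw wB]; rewrite PE expr_div_n.
  have G1 : -1 <= peval G w <= 1.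
    rewrite GE; move: Aw wB; set t := _ ^+ 2 => At tB.
    by rewrite ler_pdivlMr// ler_pdivrMr//; apply/andP; split; lra.
  rewrite (@le_trans _ _ (cheb d./2 x ^+ 2)^-1)//.
    rewrite ler_pdivrMr ?exprn_gt0// mulVf ?gt_eqF ?exprn_gt0//.
    by rewrite -real_normK ?num_real// exprn_ile1// cheb_norm_le1.
  rewrite -[leLHS]invrK -[leRHS]invrK lef_pV2 ?posrE ?invr_gt0 ?invrK
    ?exprn_gt0 ?powR_gt0//.
  by rewrite -powRN opprB cheb_needle_ge.
- move=> w wB; rewrite PE expr_div_n ler_pdivrMr ?exprn_gt0// mul1r.
  rewrite -real_normK ?num_real// lerXn2r ?nnegrE ?(ltW T0)//.
  by rewrite cheb_norm_le// Gx.
Qed.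

End needle.

Section away_from_support.
Variables (R : realType) (p d : nat).
Variables (mu mu0 : {measure set 'rV[R]_p -> \bar R}).
Hypotheses (mu_fin : (mu setT < +oo)%E) (mu0_fin : (mu0 setT < +oo)%E).
Hypothesis cmu : compact (measure_support mu).
Hypothesis cmu0 : compact (measure_support mu0).
Variable b : 'I_('C(p + d, d)) -> mpoly.mpoly p R.
Hypothesis b_on : orthonormal_polys mu0 d b.
Hypothesis d1 : (1 < d)%N.

Let s : R := Num.sqrt d%:R.

(** Let [c] be the distance from [z] to the support of [mu]. Both supports lie
    within [c + delta] of [z], and that of [mu] at distance at least [c]. The
    polynomial of [needle_mpoly] for [A = c ^ 2] and [B = (c + delta) ^ 2] is
    therefore small on the support of [mu] and bounded by 1 on that of [mu0]. The
    bound [c > delta / (sqrt d - 1)] is what makes [(A + B) / (B - A)] at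
    least [(d + 1) / (d - 1)]. *)
Lemma cd_poly_away (delta rho : R) z : 0 <= delta ->
  (forall w w', measure_support mu w ->
    (measure_support mu `|` measure_support mu0) w' -> euclid_dist w' w <= delta) ->
  delta / (s - 1) < rho ->
  (forall w, measure_support mu w -> rho <= euclid_dist w z) ->
  ((fine (mu setT) + fine (mu0 setT)) * 2 `^ (3 - s))^-1 <=
    cd_poly mu (2 `^ (3 - s)) b z.
Proof.
move=> delta0 Kdelta rho_gt rho_le.
have s1 : 1 < s := natr_sqrt_gt1 R d1.
have s10 : 0 < s - 1 by rewrite subr_gt0.
have mS := borel_closed (@closed_measure_support _ _ mu).
have mS0 := borel_closed (@closed_measure_support _ _ mu0).
have int_mu P := integrable_peval P mu_fin cmu (measure_support_null mu).
have int_mu0 P := integrable_peval P mu0_fin cmu0 (measure_support_null mu0).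
set beta := 2 `^ (3 - s); have beta0 : 0 < beta by exact: powR_gt0.
suff [P [Pd Pz Pmu Pmu0]] : exists P : mpoly.mpoly p R,
    [/\ (mpoly.msize P <= d.+1)%N, peval P z = 1,
      forall w, measure_support mu w -> peval P w ^+ 2 <= beta &
      forall w, measure_support mu0 w -> peval P w ^+ 2 <= 1].
  apply: (cd_poly_ge int_mu int_mu0 b_on beta0 Pd Pz).
  have := pint_sqr_le int_mu mS mu_fin (measure_support_null mu) (ltW beta0) Pmu.
  have := pint_sqr_le int_mu0 mS0 mu0_fin (measure_support_null mu0) ler01 Pmu0.
  rewrite mul1r -(ler_pM2l beta0); lra.
have [S0|] := eqVneq (measure_support mu) set0.
  exists 1; split.
  - by rewrite msize1.
  - by rewrite /peval meval1.
  - by move=> w; rewrite S0.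
  - by move=> w _; rewrite /peval meval1 expr1n.
move=> /set0P S0.
pose D := [set euclid_dist w z | w in measure_support mu].
have D0 : D !=set0 by case: S0 => w Sw; exists (euclid_dist w z), w.
have Drho : lbound D rho by move=> _ [w Sw <-]; exact: rho_le.
have rho0 : 0 < rho by rewrite (le_lt_trans _ rho_gt)// divr_ge0// ltW.
pose c := inf D; have rc : rho <= c by exact: lb_le_inf.
have cD w : measure_support mu w -> c <= euclid_dist w z.
  by move=> Sw; apply: ge_inf; [exists rho|exists w].
(* [delta] is enlarged to make room for a point that only nearly attains [c],
   and to make it positive *)
pose delta1 := rho * (s - 1).
have delta1_gt : delta < delta1 by rewrite -ltr_pdivrMr.
have [_ [w0 Sw0 <-] w0c] : exists2 e, D e & e < c + (delta1 - delta).
  by apply: inf_adherent; [rewrite subr_gt0|split => //; exists rho].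
have zK w : (measure_support mu `|` measure_support mu0) w ->
    euclid_dist w z <= c + delta1.
  move=> Kw; rewrite (le_trans (euclid_dist_triangle w0 _ _))//.
  by have := Kdelta _ _ Sw0 Kw; lra.
have delta10 : 0 < delta1 by exact: le_lt_trans delta1_gt.
have c0 : 0 < c by exact: lt_le_trans rc.
have [|||P [Pd Pz P1 P2]] := @needle_mpoly R p d z (c ^+ 2) ((c + delta1) ^+ 2) d1.
- exact: sqr_ge0.
- by rewrite ltrXn2r ?ltrDl ?nnegrE ?addr_ge0 ?(ltW c0) ?(ltW delta10).
- have sd : s ^+ 2 = d%:R by rewrite sqr_sqrtr.
  have BdA : (c + delta1) ^+ 2 <= d%:R * c ^+ 2.
    have sc0 : 0 <= s * c by rewrite mulr_ge0 ?(ltW c0) ?(le_trans _ (ltW s1)).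
    rewrite -sd -exprMn lerXn2r ?nnegrE ?addr_ge0 ?(ltW c0) ?(ltW delta10)//.
    rewrite -lerBrDl (_ : s * c - c = c * (s - 1)); last by ring.
    by rewrite ler_pM2r.
  rewrite ler_pdivrMr ?subr_gt0 ?ltr1n// mulrAC ler_pdivlMr ?subr_gt0.
    move: BdA; set A := c ^+ 2; set B := _ ^+ 2 => BdA; lra.
  by rewrite ltrXn2r ?ltrDl ?nnegrE ?addr_ge0 ?(ltW c0) ?(ltW delta10).
exists P; split => //.
- move=> w Sw; apply: P1; apply/andP; split.
    by rewrite lerXn2r ?nnegrE ?euclid_dist_ge0 ?(ltW c0)// cD.
  by rewrite lerXn2r ?nnegrE ?euclid_dist_ge0 ?addr_ge0 ?(ltW c0)
    ?(ltW delta10)// zK//; left.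
- move=> w Sw; apply: P2.
  by rewrite lerXn2r ?nnegrE ?euclid_dist_ge0 ?addr_ge0 ?(ltW c0)
    ?(ltW delta10)// zK//; right.
Qed.

End away_from_support.

(** * Diameters, minimizers and oscillation *)

Section diameter.
Variables (R : realType) (T : Type) (dist : T -> T -> R) (A : set T).

Lemma le_diam (B : R) x y : (forall x y, A x -> A y -> dist x y <= B) ->
  A x -> A y -> dist x y <= diam dist A.
Proof.
move=> AB Ax Ay; apply: ub_le_sup; last by exists x => //; exists y.
by exists B => _ [x' Ax' [y' Ay' <-]]; exact: AB.
Qed.

Lemma diam_ge0 : (forall x y, 0 <= dist x y) -> 0 <= diam dist A.
Proof.
move=> d0; rewrite /diam; set D := [set _ | _ in _ & _ in _].
have [[[r Dr] ubD]|/sup_out->//] := pselect (has_sup D).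
apply: le_trans (ub_le_sup ubD Dr).
by case: Dr => x _ [y _ <-].
Qed.

End diameter.

Section argmin.
Variable R : realType.

Lemma argmin_set_min (Y : set R) (g : R -> R) : compact Y -> Y !=set0 ->
  continuous g -> argmin Y g (set_min (argmin Y g)).
Proof.
move=> cY Y0 cg.
have cgY : {within Y, continuous g} by exact: continuous_subspaceT.
have [y0 /set_mem Yy0 y0min] := compact_EVT_min Y0 cY cgY.
have AE : argmin Y g = Y `&` [set y | g y <= g y0].
  apply/seteqP; split => y [Yy gy]; split => //; first exact: gy.
  by move=> y' Yy'; rewrite (le_trans gy)// y0min// inE.
have cA : compact (argmin Y g).
  rewrite AE; apply: compact_closedI => //.
  by apply: (closed_comp _ (closed_le (y := g y0))) => y _; exact: cg.
have A0 : argmin Y g !=set0 by exists y0; split => // y' Yy'; rewrite y0min// inE.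
have cid : {within argmin Y g, continuous (@id R)}.
  by apply: continuous_subspaceT => y; exact: cvg_id.
have [y1 /set_mem Ay1 y1min] := compact_EVT_min A0 cA cid.
rewrite /set_min; case: xgetP => [y _ []//|H].
by have := H y1; case; split => // y Ay; apply: y1min; rewrite inE.
Qed.

End argmin.

(** The integral of a nonnegative function is a supremum over the simple functions
    below it, so it is monotone even among functions that may fail to be
    measurable. Errors of [cd_approx] are integrated through this lemma. *)
Lemma le_integral_nomeas d (T : measurableType d) (R : realType)
    (nu : {measure set T -> \bar R}) (D : set T) (g h : T -> \bar R) :
  (forall x, D x -> 0 <= g x)%E -> (forall x, D x -> g x <= h x)%E ->
  (\int[nu]_(x in D) g x <= \int[nu]_(x in D) h x)%E.
Proof.
move=> g0 gh.
have h0 x : D x -> (0 <= h x)%E by move=> Dx; exact: le_trans (g0 _ Dx) (gh _ Dx).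
rewrite !ge0_integralE//; apply: ereal_sup_le => _ [k kg <-]; exists k => //.
by move=> x; rewrite (le_trans (kg x))// lee_restrict.
Qed.

Lemma L1norm_le (R : realType) n (X E : set 'rV[R]_n) (g : 'rV[R]_n -> R) (a c : R) :
  measurable X -> measurable E -> 0 <= a -> 0 <= c ->
  (forall x, X x -> `|g x| <= c) -> (forall x, X x -> ~ E x -> `|g x| <= a) ->
  (L1norm X g <= a%:E * lebesgue X + c%:E * lebesgue E)%E.
Proof.
move=> mX mE a0 c0 gc ga.
apply: (@le_trans _ _ (\int[@lebesgue R n]_(x in X) (cst a%:E x + c%:E * (\1_E x)%:E))%E).
  apply: le_integral_nomeas => x Xx; first by rewrite lee_fin.
  rewrite /= -EFinM -EFinD lee_fin indicE.
  have [/set_mem Ex|/negP Ex] := boolP (x \in E).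
    by rewrite mulr1 (le_trans (gc x Xx))// lerDr.
  by rewrite mulr0 addr0 ga// => Ex'; apply: Ex; rewrite inE.
rewrite ge0_integralD//; last 2 first.
- by move=> x _; rewrite mule_ge0// lee_fin.
- by apply: measurable_funeM; apply/measurable_EFinP; exact: measurable_indic.
rewrite integral_cst// ge0_integralZl//; last first.
  by apply/measurable_EFinP; exact: measurable_indic.
rewrite integral_indic// leeD2l// lee_wpmul2l ?lee_fin//.
by rewrite le_measure ?inE//; exact: measurableI.
Qed.

Section oscillation.
Variables (R : realType) (n : nat) (X : set 'rV[R]_n) (f : 'rV[R]_n -> R).

(** The points within [eta] of two points of [X] between which [f] varies by more
    than [eps]. Asking for two such points, rather than comparing with the
    value at the center, makes this set open, hence measurable. *)
Definition oscillation_set (eps eta : R) : set 'rV[R]_n :=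
  \bigcup_(z in [set z | [/\ X z.1, X z.2 & eps < `|f z.1 - f z.2|]])
    (ball z.1 eta `&` ball z.2 eta).

Lemma open_oscillation_set eps eta : open (oscillation_set eps eta).
Proof. by apply: bigcup_open => z _; apply: openI; exact: ball_open. Qed.

Lemma continuity_pointsP x : continuity_points X f x ->
  forall e, 0 < e -> exists2 eta, 0 < eta &
    forall y, X y -> ball x eta y -> `|f x - f y| < e.
Proof.
move=> [Xx /cvgrPdist_lt cf] e e0.
have /nbhs_ballP[eta /= eta0 xeta] := cf e e0.
by exists eta => // y Xy xy; exact: xeta.
Qed.

(** These sets decrease with the radius, and a point of [X] in all of them is a
    discontinuity. *)
Lemma oscillation_set_cvg0 eps : compact X -> 0 < eps ->
  (@lebesgue R n).-negligible (X `\` continuity_points X f) ->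
  lebesgue (X `&` oscillation_set eps k.+1%:R^-1) @[k --> \oo] --> 0%E.
Proof.
move=> cX e0 negX.
have mX : measurable X.
  exact: borel_closed (compact_closed (@norm_hausdorff _ _) cX).
pose F k := X `&` oscillation_set eps k.+1%:R^-1.
have mF k : measurable (F k).
  by apply: measurableI => //; apply: borel_open; exact: open_oscillation_set.
have F0 : lebesgue (\bigcap_k F k) = 0%E.
  apply: measure_negligible; first exact: bigcap_measurable.
  apply: negligibleS negX => x Fx; have Xx : X x by have [] := Fx 0%N I.
  split => // /continuity_pointsP/(_ (eps / 2))[|eta eta0 xeta].
    by rewrite divr_gt0.
  have [k keta] : exists k, k.+1%:R^-1 < eta.
    exists (Num.truncn eta^-1); rewrite invf_plt ?posrE//; exact: truncnS_gt.
  have [_ [[x' x''] /= [Xx' Xx'' xx] [xx' xx'']]] := Fx k I.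
  have d y : X y -> ball y k.+1%:R^-1 x -> `|f x - f y| < eps / 2.
    by move=> Xy yx; apply: xeta => //; apply/(le_ball (ltW keta))/ball_sym.
  move: xx; rewrite ltNge => /negP; apply.
  rewrite (splitr eps) (_ : f x' - f x'' = (f x - f x'') - (f x - f x')); last by ring.
  by rewrite (le_trans (ler_normB _ _))// lerD//; apply: ltW; apply: d.
rewrite -F0; apply: (nonincreasing_cvg_mu (F := F)) => //.
- apply: le_lt_trans (compact_lebesgue_fin cX).
  by apply: le_measure; rewrite ?inE// => x [].
- exact: bigcap_measurable.
move=> j k jk; apply/subsetPset => x [Xx [z Pz [xz1 xz2]]]; split => //.
have jk' : k.+1%:R^-1 <= j.+1%:R^-1 :> R by rewrite lef_pV2 ?posrE// ler_nat ltnS.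
by exists z => //; split; exact: le_ball jk' _ _.
Qed.

End oscillation.

(** * Approximation off a small set *)

Section approximation_off_a_small_set.
Variables (R : realType) (n : nat) (X : set 'rV[R]_n) (Y : set R).
Variable f : 'rV[R]_n -> R.
Variable mu0 : {measure set 'rV[R]_n.+1 -> \bar R}.
Variable b : forall d : nat, 'I_('C(n.+1 + d, d)) -> mpoly.mpoly n.+1 R.
Hypotheses (cX : compact X) (cY : compact Y) (fXY : forall x, X x -> Y (f x)).
Hypothesis mf : measurable_fun X f.
Hypothesis mu0_cs : compact (measure_support mu0).
Hypothesis b_on : forall d, orthonormal_polys mu0 d (@b d).

Let mu := graph_measure X f.
Let m := fine (mu setT).
Let m0 := fine (mu0 setT).
Let delta0 := diam (@euclid_dist R n.+1) (measure_support (mu \+ mu0)%E).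
Let beta (d : nat) : R := 2 `^ (3 - Num.sqrt d%:R).
Let fd (d : nat) : 'rV[R]_n -> R := cd_approx mu (beta d) (@b d) Y.

Let mX : measurable X.
Proof. exact: borel_closed (compact_closed (@norm_hausdorff _ _) cX). Qed.

Lemma graph_measureT : mu setT = lebesgue X.
Proof. by congr lebesgue; apply/seteqP; split => x /=; [case|]. Qed.

Lemma graph_measure_fin : (mu setT < +oo)%E.
Proof. by rewrite graph_measureT; exact: compact_lebesgue_fin. Qed.

Lemma graph_support_sub F : closed F -> (forall x, X x -> F (snoc x (f x))) ->
  measure_support mu `<=` F.
Proof.
move=> cF XF; apply: measure_support_sub => //; rewrite /mu /graph_measure.
rewrite (_ : [set _ | _] = set0) ?measure0//.
by apply/seteqP; split => // x [Xx] /(_ (XF x Xx)).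
Qed.

(** The constant polynomial in an orthonormal family has square integral 1. *)
Lemma orthonormal_polys_mass : (0 < mu0 setT < +oo)%E.
Proof.
have N0 : (0 < 'C(n.+1 + 0, 0))%N by rewrite bin0.
have [b0 ob0] := b_on 0; pose i := Ordinal N0.
have bE := msize1_polyC (b0 i); have := ob0 i i; rewrite eqxx bE.
set c := mpoly.mcoeff _ _.
under eq_integral do rewrite /peval mevalC.
rewrite (integral_cst mu0 measurableT) => h; apply/andP; split.
  rewrite lt0e measure_ge0 andbT; apply/eqP => h0.
  by move/eqP: h; rewrite h0 mule0 eqe eq_sym oner_eq0.
rewrite ltey; apply/eqP => h0; move: h; rewrite h0.
have [->|c0] := eqVneq (c * c) 0.
  by rewrite mul0e => -[/eqP]; rewrite eq_sym oner_eq0.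
by rewrite gt0_muley// lte_fin lt_neqAle eq_sym c0 -expr2 sqr_ge0.
Qed.

Let m0_gt0 : 0 < m0.
Proof. by rewrite fine_gt0// orthonormal_polys_mass. Qed.

Let m_ge0 : 0 <= m.
Proof. by rewrite /m graph_measureT fine_ge0. Qed.

Let D := diam (fun y y' : R => `|y - y'|) Y.

Lemma graph_cube : exists2 B : R, 0 <= B & forall x, X x -> @cube R n.+1 B (snoc x (f x)).
Proof.
have [B1 B10 XB1] := compact_cube cX.
have [B2 [B2r YB2]] := compact_bounded cY.
exists (B1 + (`|B2| + 1)); first by rewrite !addr_ge0.
move=> x Xx i; case: (unliftP ord_max i) => [j ->|->].
  by rewrite snoc_lift (le_trans (XB1 x Xx j))// lerDl addr_ge0.
rewrite snoc_max (@le_trans _ _ (`|B2| + 1))//; last by rewrite lerDr.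
by apply: YB2; [rewrite ltr_pwDr// ler_norm|exact: fXY].
Qed.

Lemma compact_graph_support : compact (measure_support mu).
Proof.
have [B B0 XB] := graph_cube.
apply: (bounded_closed_cube B0); first exact: closed_measure_support.
by apply: graph_support_sub => //; exact: closed_cube.
Qed.

Lemma support_sum_sub (nu : set 'rV[R]_n.+1 -> \bar R) :
  (forall A, 0 <= nu A)%E -> (forall A, nu A <= (mu \+ mu0) A)%E ->
  measure_support nu `<=` measure_support (mu \+ mu0)%E.
Proof.
move=> nu0 nule z nuz F [cF F0]; apply: nuz; split => //.
by apply/eqP; rewrite eq_le nu0 andbT -F0 nule.
Qed.

Lemma euclid_dist_support w w' : measure_support mu w ->
  (measure_support mu `|` measure_support mu0) w' ->
  euclid_dist w' w <= delta0.
Proof.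
have mu_ge0 A : (0 <= mu A)%E by exact: measure_ge0.
have subK : measure_support mu `|` measure_support mu0 `<=`
    measure_support (mu \+ mu0)%E.
  rewrite subUset; split; apply: support_sum_sub => // A.
    by rewrite /= leeDl.
  by rewrite /= leeDr.
move=> Sw Sw'.
have [B B0 XB] := graph_cube; have [B' B'0 SB'] := compact_cube mu0_cs.
have KB : measure_support (mu \+ mu0)%E `<=` @cube R n.+1 (B + B').
  apply: measure_support_sub; first exact: closed_cube.
  rewrite /= [X in (X + _)%E](_ : _ = 0%E) ?add0e.
    apply/eqP; rewrite eq_le measure_ge0 andbT -(measure_support_null mu0).
    apply: le_measure; rewrite ?inE.
    - by apply: measurableC; apply: borel_closed; exact: closed_cube.
    - by apply: measurableC; apply: borel_closed; exact: closed_measure_support.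
    - apply: subsetC => z /SB' zB i; by rewrite (le_trans (zB i))// lerDr.
  rewrite /mu /graph_measure (_ : [set _ | _] = set0) ?measure0//.
  apply/seteqP; split => // x [Xx] /=; apply => i.
  by rewrite (le_trans (XB x Xx i))// lerDl.
apply: (le_diam (B := Num.sqrt n.+1%:R * (2 * (B + B')))); last 2 first.
- exact: subK.
- by apply: subK; left.
move=> x y /KB Kx /KB Ky; apply: euclid_dist_le_coord.
  by rewrite mulr_ge0 ?addr_ge0.
move=> i; rewrite (le_trans (ler_normB _ _))// mulr2n mulrDl mul1r.
by rewrite lerD.
Qed.

Lemma delta0_ge0 : 0 <= delta0.
Proof. by apply: diam_ge0 => x y; exact: euclid_dist_ge0. Qed.

Let t (d : nat) : R := ((m + m0) * beta d)^-1.

Let t_gt0 d : 0 < t d.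
Proof. by rewrite invr_gt0 mulr_gt0 ?powR_gt0// ltr_wpDl. Qed.

Let muP : {mu' : {measure set 'rV[R]_n.+1 -> \bar R} | mu = mu'}.
Proof. exact/cid/graph_measureP. Qed.

Let int_mu P : (sval muP).-integrable setT (EFin \o peval P).
Proof.
case: muP => mu' /= E; apply: (@integrable_peval _ _ _ (measure_support mu)).
- by rewrite -E graph_measure_fin.
- exact: compact_graph_support.
- by rewrite {1}E; exact: measure_support_null.
Qed.

Let int_mu0 P : mu0.-integrable setT (EFin \o peval P).
Proof.
apply: integrable_peval mu0_cs (measure_support_null mu0).
by case/andP: orthonormal_polys_mass.
Qed.

Let beta_gt0 d : 0 < beta d.
Proof. exact: powR_gt0. Qed.

Lemma cd_approx_argmin d x : X x ->
  argmin Y (fun y => cd_poly mu (beta d) (@b d) (snoc x y)) (fd d x).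
Proof.
move=> Xx; apply: argmin_set_min => //; first by exists (f x); exact: fXY.
move=> y; apply: continuous_comp; first exact: continuous_snoc.
by rewrite (svalP muP); exact: continuous_cd_poly.
Qed.

Lemma cd_approx_diam d x : X x -> `|f x - fd d x| <= D.
Proof.
move=> Xx; have [Yfd _] := cd_approx_argmin d Xx.
have [B [Br YB]] := compact_bounded cY.
apply: (le_diam (B := (`|B| + 1) + (`|B| + 1))) => //; last exact: fXY.
move=> y y' Yy Yy'; rewrite (le_trans (ler_normB _ _))//.
by rewrite lerD// YB// ltr_pwDr// ler_norm.
Qed.

(** The points over which [cd_poly] exceeds, on the graph, the lower bound that
    [cd_poly_away] gives away from the graph. *)
Definition bad_set d : set 'rV[R]_n :=
  [set x | X x /\ t d <= cd_poly mu (beta d) (@b d) (snoc x (f x))].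

Lemma measurable_bad_set d : measurable (bad_set d).
Proof.
pose q := cd_poly mu (beta d) (@b d).
have cq : continuous q.
  rewrite /q (svalP muP).
  exact: continuous_cd_poly.
have -> : bad_set d = X `&` (fun x => snoc x ((f \_ X) x)) @^-1` [set z | t d <= q z].
  by apply/seteqP; split => x [Xx] /=; rewrite patchE mem_set.
apply: measurableI => //; rewrite -[X in measurable X]setTI.
apply: measurable_graph => //; apply: borel_closed.
by apply: (closed_comp _ (closed_ge (y := t d))) => z _; exact: cq.
Qed.

(** Markov's inequality under the graph measure, for which the set has the measure
    of its projection to [X]. *)
Lemma lebesgue_bad_set_le d :
  (lebesgue (bad_set d) <=
    (8 * (m + m0) * ('C(n.+1 + d, d)%:R * 2 `^ (- Num.sqrt d%:R)))%:E)%E.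
Proof.
have -> : lebesgue (bad_set d) =
  mu [set z | t d <= cd_poly mu (beta d) (@b d) z] by [].
have := cd_poly_markov int_mu int_mu0 (b_on d) (beta_gt0 d) (t_gt0 d).
rewrite -!(svalP muP) => /le_trans; apply; rewrite lee_fin.
rewrite /t invrK (_ : beta d = 8 * 2 `^ (- Num.sqrt d%:R)).
  by rewrite le_eqVlt; apply/orP; left; apply/eqP; ring.
rewrite /beta powRD ?pnatr_eq0 ?implybT//; congr (_ * _).
by rewrite powR_mulrn//; lra.
Qed.

(** Off the bad set, [cd_poly] is below the threshold of [cd_poly_away] at
    [(x, f x)], hence also at [(x, fd d x)] by minimality. *)
Lemma cd_approx_close d x rho : (1 < d)%N -> X x -> ~ bad_set d x ->
  delta0 / (Num.sqrt d%:R - 1) < rho ->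
  exists x', [/\ X x', euclid_dist x x' < rho & `|fd d x - f x'| < rho].
Proof.
move=> d1 Xx xbad rho_gt; apply: contrapT => H.
have far x' : X x' -> rho <= euclid_dist (snoc x' (f x')) (snoc x (fd d x)).
  move=> Xx'; rewrite leNgt; apply/negP => close; apply: H; exists x'; split => //.
    by rewrite euclid_distC (le_lt_trans (ler_euclid_dist_snoc _ _ _ _) close).
  apply: le_lt_trans close; rewrite euclid_distC.
  have := ler_coord_euclid_dist (snoc x (fd d x)) (snoc x' (f x')) ord_max.
  by rewrite !snoc_max.
have [Yfd fd_min] := cd_approx_argmin d Xx.
apply: xbad; split => //; apply: le_trans (fd_min _ (fXY Xx)).
have sub : measure_support mu `<=` [set w | rho <= euclid_dist w (snoc x (fd d x))].
  apply: graph_support_sub => //.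
  apply: (closed_comp _ (closed_ge (y := rho))) => w _.
  exact: continuous_euclid_dist.
have mu0_fin : (mu0 setT < +oo)%E by case/andP: orthonormal_polys_mass.
have := @cd_poly_away R n.+1 d (sval muP) mu0.
rewrite -!(svalP muP).
move=> /(_ graph_measure_fin mu0_fin compact_graph_support mu0_cs _ (b_on d) d1).
move=> /(_ delta0 rho); apply => //; first exact: delta0_ge0.
exact: euclid_dist_support.
Qed.

(** * Convergence and rates *)

Let tail (d : nat) : R := 8 * (m + m0) * ('C(n.+1 + d, d)%:R * 2 `^ (- Num.sqrt d%:R)).

Lemma tail_le d (r : R) : (1 < d)%N -> n.+1%:R < r ->
  tail d <= (8 * (m + m0) * (3 * r) `^ (2 * r) * expR (n.+1%:R ^+ 2 / d%:R)) /
    (n.+1%:R ^+ n.+1 * expR (2 * r - n.+1%:R) * d%:R `^ (r - n.+1%:R)).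
Proof.
move=> d1 pr; rewrite /tail -!mulrA ler_wpM2l// ler_wpM2l ?addr_ge0 ?(ltW m0_gt0)//.
by have := bin_tail_le d1 pr; rewrite -!mulrA.
Qed.

(** Off the bad set, [cd_approx_close] and the Lipschitz condition bound the error by
    [(1 + L) * rho] for all [rho > delta0 / (sqrt d - 1)]. *)
Lemma L1_cd_approx_lipschitz (L : R) : 0 < L ->
  (forall x x', X x -> X x' -> `|f x - f x'| <= L * euclid_dist x x') ->
  forall d, (1 < d)%N ->
  (L1norm X (f \- fd d)%R <=
    (fine (lebesgue X) * (delta0 / (Num.sqrt d%:R - 1)) * (1 + L) +
      D * tail d)%:E)%E.
Proof.
move=> L0 fL d d1; have s1 := natr_sqrt_gt1 R d1.
set delta := delta0 / _.
have delta_ge0 : 0 <= delta by rewrite divr_ge0 ?delta0_ge0// subr_ge0 ltW.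
have D0 : 0 <= D by exact: diam_ge0.
apply: (le_trans (L1norm_le (E := bad_set d) (a := (1 + L) * delta) mX _ _ D0 _ _)).
- exact: measurable_bad_set.
- by rewrite mulr_ge0// addr_ge0// ltW.
- by move=> x Xx; exact: cd_approx_diam.
- move=> x Xx xbad; apply/ler_addgt0Pr => e e0.
  have L10 : 0 < 1 + L by rewrite addr_gt0.
  have [|x' [Xx' xx' fdx']] := cd_approx_close d1 Xx xbad (rho := delta + e / (1 + L)).
    by rewrite ltrDl divr_gt0.
  have -> : (1 + L) * delta + e = L * (delta + e / (1 + L)) + (delta + e / (1 + L)).
    by field; rewrite gt_eqF.
  rewrite (_ : (f \- fd d) x = (f x - f x') + - (fd d x - f x')); last first.
    by rewrite /=; ring.
  rewrite (le_trans (ler_normD _ _))// normrN lerD// ?(ltW fdx')//.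
  by rewrite (le_trans (fL _ _ Xx Xx'))// ler_pM2l// ltW.
rewrite EFinD leeD//.
  rewrite -[X in (_ * X)%E]fineK ?ge0_fin_numE ?compact_lebesgue_fin//.
  by rewrite -EFinM lee_fin le_eqVlt; apply/orP; left; apply/eqP; ring.
by rewrite EFinM lee_wpmul2l ?lee_fin//; exact: lebesgue_bad_set_le.
Qed.

(** The bound of [tail_le] with [r := p + 2], so that [d] appears with exponent
    [r - p = 2], which is summable. *)
Lemma tail_bound : exists2 K : R, 0 <= K & forall d, (1 < d)%N -> tail d <= K / d%:R ^+ 2.
Proof.
pose p : R := n.+1%:R; pose r := p + 2.
have pr : p < r by rewrite ltrDl.
pose K := (8 * (m + m0) * (3 * r) `^ (2 * r) * expR (p ^+ 2)) /
  (p ^+ n.+1 * expR (2 * r - p)).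
have mm0 : 0 <= 8 * (m + m0) by rewrite mulr_ge0 ?addr_ge0 ?(ltW m0_gt0).
have pp : 0 < p ^+ n.+1 * expR (2 * r - p) by rewrite mulr_gt0 ?expR_gt0 ?exprn_gt0.
exists K.
  by rewrite divr_ge0 ?(ltW pp)// !mulr_ge0 ?powR_ge0 ?expR_ge0 ?addr_ge0 ?(ltW m0_gt0).
move=> d d1; apply: le_trans (tail_le d1 pr) _.
have -> : r - p = 2%:R by rewrite /r; ring.
have d0 : 0 < d%:R :> R by rewrite ltr0n (ltn_trans _ d1).
rewrite powR_mulrn ?(ltW d0)// /K -/p.
rewrite -[X in _ <= X]mulrA -invfM.
rewrite ler_pM2r ?invr_gt0 ?mulr_gt0 ?exprn_gt0 ?expR_gt0//.
rewrite ler_wpM2l ?(mulr_ge0 mm0) ?powR_ge0// ler_expR ler_pdivrMr//.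
by rewrite ler_peMr ?sqr_ge0// ler1n ltnW.
Qed.

Lemma delta_small rho : 0 < rho ->
  \forall d \near \oo, (1 < d)%N /\ delta0 / (Num.sqrt d%:R - 1) < rho.
Proof.
move=> rho0; pose M := 1 + delta0 / rho.
have M0 : 0 <= M by rewrite addr_ge0// divr_ge0 ?delta0_ge0 ?ltW.
near=> d; have d1 : (1 < d)%N by near: d; exact: nbhs_infty_gt.
split => //; have s1 := natr_sqrt_gt1 R d1.
rewrite ltr_pdivrMr ?subr_gt0// mulrC -ltr_pdivrMr// ltrBrDl.
rewrite -/M -[ltLHS](ger0_norm M0) -sqrtr_sqr ltr_sqrt ?ltr0n ?(ltn_trans _ d1)//.
by near: d; exact: nbhs_infty_gtr.
Unshelve. all: by end_near. Qed.

Lemma tail_small e : 0 < e -> \forall d \near \oo, tail d < e.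
Proof.
move=> e0; have [K K0 tK] := tail_bound.
near=> d; have d1 : (1 < d)%N by near: d; exact: nbhs_infty_gt.
have d0 : 0 < d%:R :> R by rewrite ltr0n (ltn_trans _ d1).
apply: le_lt_trans (tK d d1) _; rewrite ltr_pdivrMr ?exprn_gt0//.
have Kd : K / e < d%:R by near: d; exact: nbhs_infty_gtr.
rewrite -ltr_pdivrMl// mulrC (lt_le_trans Kd)// expr2 ler_peMr ?(ltW d0)//.
by rewrite ler1n ltnW.
Unshelve. all: by end_near. Qed.

(** Borel-Cantelli: the measures of the bad sets are summable. *)
Lemma bad_set_limsup : (@lebesgue R n).-negligible (lim_sup_set (fun k => bad_set k.+2)).
Proof.
have mB k : measurable (bad_set k.+2) by exact: measurable_bad_set.
apply/negligibleP.
  apply: bigcap_measurable => // i _; exact: bigcup_measurable.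
apply: lim_sup_set_cvg0 => //.
have [K K0 tK] := tail_bound.
apply: (@le_lt_trans _ _ K%:E); last exact: ltry.
apply: lime_le; first exact: is_cvg_nneseries.
near=> N; apply: (@le_trans _ _ (K * (1 - N.+1%:R^-1))%:E); last first.
  by rewrite lee_fin ler_piMr// gerBl invr_ge0.
elim: (N : nat) => [|k IHk]; first by rewrite big_geq// invr1 subrr mulr0.
rewrite big_nat_recr//= (le_trans (leeD IHk (lebesgue_bad_set_le k.+2)))//.
rewrite -EFinD lee_fin -/(tail _) (le_trans (lerD (lexx _) (tK _ _)))//.
rewrite -mulrDr ler_wpM2l//.
have k1 : 0 < k.+1%:R :> R by [].
have -> : k.+2%:R = k.+1%:R + 1 :> R by rewrite -[k.+2]addn1 natrD.
move: k1; set a : R := k.+1%:R => a0.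
(* the terms [1 / (k + 2) ^ 2] are below [1 / (k + 1) - 1 / (k + 2)], which
   telescopes *)
rewrite -subr_ge0 (_ : _ - _ = (a * (a + 1) ^+ 2)^-1); last first.
  by field; rewrite !gt_eqF// addr_gt0.
by rewrite invr_ge0 mulr_ge0 ?sqr_ge0// ltW.
Unshelve. all: by end_near. Qed.

Hypothesis neg_disc : (@lebesgue R n).-negligible (X `\` continuity_points X f).

(** Almost every point is a continuity point and belongs to finitely many bad sets;
    there, [cd_approx_close] gives points [x'] that tend to [x] with [f x' - fd d x]
    tending to 0. *)
Lemma cd_approx_ae_cvg : {ae @lebesgue R n, forall x, X x -> fd d x @[d --> \oo] --> f x}.
Proof.
apply: negligibleS (negligibleU neg_disc bad_set_limsup) => x /= /not_implyP[Xx ncvg].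
have [Sx|] := pselect (continuity_points X f x); last by move=> nSx; left.
right; apply: contrapT => /existsNP[N /not_implyP[_ xN]]; apply: ncvg.
apply/cvgrPdist_lt => e e0.
have [eta eta0 xeta] := continuity_pointsP Sx (divr_gt0 e0 (ltr0Sn _ 1)).
pose rho := Num.min eta (e / 2).
have rho0 : 0 < rho by rewrite lt_min eta0 divr_gt0.
near=> d.
have [d1 drho] : (1 < d)%N /\ delta0 / (Num.sqrt d%:R - 1) < rho.
  by near: d; exact: delta_small.
have Nd : (N.+2 <= d)%N by near: d; exact: nbhs_infty_ge.
have xbad : ~ bad_set d x.
  have dE : d.-2.+2 = d by case: (d) d1 => [|[]].
  by move=> xd; apply: xN; exists d.-2; rewrite /= ?dE// -2!ltnS dE.
have [x' [Xx' xx' fdx']] := cd_approx_close d1 Xx xbad drho.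
rewrite (_ : f x - fd d x = (f x - f x') - (fd d x - f x')); last by ring.
rewrite (le_lt_trans (ler_normB _ _))// (splitr e) ltrD//.
  apply: xeta => //; apply: euclid_dist_ball; rewrite (lt_le_trans xx')//.
  by rewrite ge_min lexx.
by rewrite (lt_le_trans fdx')// ge_min lexx orbT.
Unshelve. all: by end_near. Qed.

(** Off the bad set and the oscillation set, the error is small; on these two small
    sets, it is at most the diameter of [Y]. *)
Lemma cd_approx_L1_cvg : L1norm X (f \- fd d) @[d --> \oo] --> 0%E.
Proof.
pose V := fine (lebesgue X).
have V0 : 0 <= V by rewrite fine_ge0.
have D0 : 0 <= D by exact: diam_ge0.
have VE : lebesgue X = V%:E by rewrite fineK// ge0_fin_numE// compact_lebesgue_fin.
suff H e : 0 < e -> \forall d \near \oo, (L1norm X (f \- fd d)%R <= e%:E)%E.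
  have L1_ge0 d : (0 <= L1norm X (f \- fd d)%R)%E by apply: integral_ge0.
  apply/fine_cvgP; split.
    apply: filterS (H 1 ltr01) => d Hd.
    by rewrite ge0_fin_numE// (le_lt_trans Hd)// ltry.
  apply/cvgrPdist_le => e e0; apply: filterS (H e e0) => d Hd /=.
  rewrite sub0r normrN ger0_norm ?fine_ge0// -lee_fin fineK//.
  by rewrite ge0_fin_numE// (le_lt_trans Hd)// ltry.
move=> e0.
pose eps := e / (4 * (V + 1)); pose e' := e / (4 * (D + 1)).
have eps0 : 0 < eps by rewrite divr_gt0// mulr_gt0// ltr_wpDl.
have e'0 : 0 < e' by rewrite divr_gt0// mulr_gt0// ltr_wpDl.
have [k kosc] : exists k,
    (lebesgue (X `&` oscillation_set X f eps k.+1%:R^-1) <= e'%:E)%E.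
  have /fine_cvgP[[N1 _ fin1] /cvgrPdist_le/(_ e' e'0)[N2 _ small]] :=
    oscillation_set_cvg0 cX eps0 neg_disc.
  exists (maxn N1 N2); rewrite -[leLHS]fineK; last by apply: fin1; exact: leq_maxl.
  have := small (maxn N1 N2) (leq_maxr _ _).
  by rewrite sub0r normrN lee_fin => /(le_trans (ler_norm _)).
set O := X `&` _ in kosc.
have mO : measurable O.
  by apply: measurableI => //; apply: borel_open; exact: open_oscillation_set.
pose rho := Num.min k.+1%:R^-1 eps.
have rho0 : 0 < rho by rewrite lt_min eps0 invr_gt0 ltr0n.
near=> d.
have [d1 drho] : (1 < d)%N /\ delta0 / (Num.sqrt d%:R - 1) < rho.
  by near: d; exact: delta_small.
have td : tail d < e' by near: d; exact: tail_small.
have mB := measurable_bad_set d.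
apply: (le_trans (L1norm_le (E := bad_set d `|` O) (a := eps + eps) mX _ _ D0 _ _)).
- exact: measurableU.
- by rewrite addr_ge0// ltW.
- by move=> x Xx; exact: cd_approx_diam.
- move=> x Xx /not_orP[xbad xO].
  have [x' [Xx' xx' fdx']] := cd_approx_close d1 Xx xbad drho.
  rewrite (_ : (f \- fd d) x = (f x - f x') - (fd d x - f x')); last by rewrite /=; ring.
  rewrite (le_trans (ler_normB _ _))// lerD//; last first.
    by rewrite ltW// (lt_le_trans fdx')// ge_min lexx orbT.
  rewrite leNgt; apply/negP => xx'eps; apply: xO; split => //.
  exists (x, x') => //; split => /=; first by apply: ballxx; rewrite invr_gt0 ltr0n.
  apply: ball_sym; apply: euclid_dist_ball; rewrite (lt_le_trans xx')//.
  by rewrite ge_min lexx.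
rewrite VE (@le_trans _ _ ((eps + eps) * V + D * (e' + e'))%:E)//.
  rewrite [leRHS]EFinD leeD// [leRHS]EFinM lee_wpmul2l ?lee_fin//.
  rewrite (le_trans (measureU2 _ _ _))// [leRHS]EFinD leeD//.
  by rewrite (le_trans (lebesgue_bad_set_le d))// lee_fin ltW.
rewrite lee_fin.
have -> : (eps + eps) * V + D * (e' + e') = e / 2 * (V / (V + 1)) + e / 2 * (D / (D + 1)).
  by rewrite /eps /e'; field; rewrite !gt_eqF// ltr_wpDl.
have h (a : R) : 0 <= a -> e / 2 * (a / (a + 1)) <= e / 2.
  move=> a0; rewrite ler_piMr ?divr_ge0 ?(ltW e0)// ler_pdivrMr ?ltr_wpDl//.
  by rewrite mul1r lerDl.
by rewrite [leRHS](splitr e) lerD// h.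
Unshelve. all: by end_near. Qed.

End approximation_off_a_small_set.

Theorem theorem1 (R : realType) (n : nat) (hn : (1 <= n)%N)
    (X : set 'rV[R]_n) (Y : set R) (f : 'rV[R]_n -> R)
    (mu0 : {measure set 'rV[R]_n.+1 -> \bar R})
    (b : forall d : nat, 'I_('C(n.+1 + d, d)) -> mpoly.mpoly n.+1 R)
    (cX : compact X) (XE : X = closure (X°)) (cY : compact Y)
    (fXY : forall x, X x -> Y (f x)) (mf : measurable_fun X f)
    (mu0_ac : mu0 `<< @lebesgue R n.+1)
    (mu0_cs : compact (measure_support mu0))
    (b_on : forall d, orthonormal_polys mu0 d (b d)) :
  let p := n.+1 in
  let mu := graph_measure X f in
  let m := fine (mu setT) in
  let m0 := fine (mu0 setT) in
  let vol_X := fine (lebesgue X) in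
  let delta0 := diam (@euclid_dist R p) (measure_support (mu \+ mu0)%E) in
  let diam_Y := diam (fun y y' : R => `|y - y'|) Y in
  let beta (d : nat) : R := 2 `^ (3 - Num.sqrt d%:R) in
  let fd (d : nat) : 'rV[R]_n -> R := cd_approx mu (beta d) (b d) Y in
  ((@lebesgue R n).-negligible (X `\` continuity_points X f) ->
    {ae @lebesgue R n, forall x, X x -> fd d x @[d --> \oo] --> f x} /\
    L1norm X (f \- fd d) @[d --> \oo] --> 0%E) /\
  (forall L : R, 0 < L ->
    (forall x x', X x -> X x' -> `|f x - f x'| <= L * euclid_dist x x') ->
    forall (d : nat) (r : R), (1 < d)%N -> p%:R < r ->
      (L1norm X (f \- fd d)%R <=
        (vol_X * (delta0 / (Num.sqrt d%:R - 1)) * (1 + L)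
         + diam_Y *
           ((8 * (m + m0) * (3 * r) `^ (2 * r) * expR (p%:R ^+ 2 / d%:R)) /
            (p%:R ^+ p * expR (2 * r - p%:R) * d%:R `^ (r - p%:R))))%:E)%E).
Proof.
move=> p mu m m0 vol_X delta0 diam_Y beta fd; split=> [neg_disc|L L0 fL d r d1 pr].
  split.
    exact: (cd_approx_ae_cvg cX cY fXY mf mu0_cs b_on neg_disc).
  exact: (cd_approx_L1_cvg cX cY fXY mf mu0_cs b_on neg_disc).
apply: le_trans (L1_cd_approx_lipschitz cX cY fXY mf mu0_cs b_on L0 fL d1) _.
rewrite lee_fin lerD2l ler_wpM2l//; first exact: diam_ge0.
exact: (tail_le X f b_on d1 pr).
Qed.
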